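(* Let $Y$ be one of the spaces $c_0(\mathbb{Z})$ or $\ell^p(\mathbb{Z})$, $1\le p<\infty$. Let $T\colon X\to X$ be an operator and let $\mathcal{F}$ be a full family. Then the following assertions are equivalent: (1) $T$ is $\bigl(\widetilde{\mathcal{F}}\bigr)^*$-transitive; (2) $T$ is weakly disjoint from all $\mathcal{F}$-mixing operators; (3) $T$ is weakly disjoint from all invertible $\mathcal{F}$-mixing bilateral weighted backward shifts on $Y$.
   Context: $\mathbb{N}_0$ is the set of non-negative integers. An operator $T\colon X\to X$ is a continuous linear self-map of an infinite-dimensional separable Fréchet space $X$ over $\mathbb{K}=\mathbb{R}$ or $\mathbb{C}$; it is invertible if it is bijective with continuous inverse. A (Furstenberg) family is a collection $\mathcal{F}$ of subsets of $\mathbb{N}_0$ that is hereditary upward ($A\in\mathcal{F}$, $A\subset B\subset\mathbb{N}_0$ imply $B\in\mathcal{F}$), with the conventions $\mathcal{F}\ne\emptyset$ and $\emptyset\notin\mathcal{F}$. Its dual is $\mathcal{F}^*=\{A\subset\mathbb{N}_0: A\cap B\ne\emptyset \text{ for all } B\in\mathcal{F}\}$. $\mathcal{F}$ is full if $F\cap F'$ is infinite for all $F\in\mathcal{F}$, $F'\in\mathcal{F}^*$. With $F+i=\{m+i:m\in F\}$, define \[\widetilde{\mathcal{F}}=\Bigl\{F\in\mathcal{F}: \text{for every } k\in\mathbb{N}_0,\ \bigcap_{i=-k}^{k}(F+i)\cap\mathbb{N}_0\in\mathcal{F}\Bigr\}.\] For $U,V\subset X$, $N_T(U,V)=\{n\in\mathbb{N}_0: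 T^nU\cap V\ne\emptyset\}$. $T$ is $\mathcal{F}$-transitive if $N_T(U,V)\in\mathcal{F}$ for all non-empty open $U,V\subset X$, and $\mathcal{F}$-mixing if $T\oplus T$ is $\mathcal{F}$-transitive. $T$ is hypercyclic if some vector has dense orbit under $T$. Operators $T$ and $S$ are weakly disjoint if $T\oplus S$ is hypercyclic. A bilateral weighted backward shift on $Y$ is the operator $B_w$ given by $(B_wx)_n=w_{n+1}x_{n+1}$, $n\in\mathbb{Z}$, where $w=(w_n)_{n\in\mathbb{Z}}$ is a bounded sequence of positive reals. *)

(* Defs.v *)
From HB Require Import structures.
From mathcomp Require Import all_boot all_order all_algebra.
From mathcomp Require Import complex ring zify.
From mathcomp Require Import all_classical all_reals all_analysis.

Set Implicit Arguments.
Unset Strict Implicit.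
Unset Printing Implicit Defensive.

Import Order.TTheory GRing.Theory Num.Theory.
Import numFieldTopology.Exports numFieldNormedType.Exports.

Local Open Scope classical_set_scope.
Local Open Scope ring_scope.

Definition furstenberg_family (F : set (set nat)) : Prop :=
  [/\ (forall A B, F A -> A `<=` B -> F B), F !=set0 & ~ F set0].

Definition dual_family (F : set (set nat)) : set (set nat) :=
  [set A | forall B, F B -> A `&` B !=set0].

Definition full_family (F : set (set nat)) : Prop :=
  forall A B, F A -> dual_family F B -> infinite_set (A `&` B).

(* [F + i], as a set of integers since [i] may be negative *)
Definition translate (A : set nat) (i : int) : set int :=
  [set m%:Z + i | m in A].

Definition tilde_family (F : set (set nat)) : set (set nat) :=
  [set A | F A /\ forall k : nat,
    F [set n : nat |
       (\bigcap_(i in [set i : int | - k%:Z <= i <= k%:Z]) translate A i)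
         n%:Z]].

Section dynamics.
Context {X Y : topologicalType}.

Definition hitting_times (T : X -> X) (U V : set X) : set nat :=
  [set n | (iter n T @` U) `&` V !=set0].

Definition family_transitive (F : set (set nat)) (T : X -> X) : Prop :=
  forall U V : set X, open U -> open V -> U !=set0 -> V !=set0 ->
    F (hitting_times T U V).

Definition hypercyclic (T : X -> X) : Prop :=
  exists x : X, dense (range (fun n : nat => iter n T x)).

Definition direct_sum (T : X -> X) (S : Y -> Y) (z : X * Y) : X * Y :=
  (T z.1, S z.2).

Definition invertible (T : X -> X) : Prop :=
  exists S : X -> X, [/\ cancel T S, cancel S T & continuous S].

Definition separable_space : Prop := exists A : set X, countable A /\ dense A.

End dynamics.
Arguments separable_space : clear implicits.

Definition family_mixing {X : topologicalType} (F : set (set nat))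
  (T : X -> X) : Prop := family_transitive F (direct_sum T T).

Definition weakly_disjoint {X Y : topologicalType}
  (T : X -> X) (S : Y -> Y) : Prop := hypercyclic (direct_sum T S).

Inductive scalar_kind := RealScalars | ComplexScalars.

Definition scalar_field (R : realType) (k : scalar_kind) : numFieldType :=
  match k with RealScalars => R | ComplexScalars => R[i]%C end.

Definition of_real {R : realType} {k : scalar_kind} : R -> scalar_field R k :=
  match k with
  | RealScalars => fun r => r
  | ComplexScalars => fun r => r%:C%C
  end.

(* the norm of a numFieldType takes its values in that field; this is its
   real-valued version, see [of_real_modulus] *)
Definition modulus {R : realType} {k : scalar_kind} : scalar_field R k -> R :=
  match k with
  | RealScalars => fun z => `|z|
  | ComplexScalars => fun z => complex.Re `|z|
  end.

Section scalar_lemmas.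
Context {R : realType} {k : scalar_kind}.
Implicit Types (z t : scalar_field R k) (r s : R).

Lemma of_real_modulus z : of_real (modulus z) = `|z|.
Proof. by case: k z => //= z; rewrite RRe_real// normr_real. Qed.

Lemma of_realD r s : of_real (r + s) = of_real r + of_real s
  :> scalar_field R k.
Proof. by case: k => //=; rewrite rmorphD. Qed.

Lemma of_realM r s : of_real (r * s) = of_real r * of_real s
  :> scalar_field R k.
Proof. by case: k => //=; rewrite rmorphM. Qed.

Lemma ler_of_real r s : (of_real r <= of_real s :> scalar_field R k) = (r <= s).
Proof. by case: k => //=; rewrite lecR. Qed.

Lemma of_real0 : of_real 0 = 0 :> scalar_field R k.
Proof. by case: k. Qed.

Lemma of_real_inj : injective (@of_real R k).
Proof. by case: k => //= r s []. Qed.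

Lemma modulus_ge0 z : 0 <= modulus z.
Proof. by rewrite -(ler_of_real) of_real0 of_real_modulus. Qed.

Lemma modulusD z t : modulus (z + t) <= modulus z + modulus t.
Proof. by rewrite -ler_of_real of_realD !of_real_modulus ler_normD. Qed.

Lemma modulusM z t : modulus (z * t) = modulus z * modulus t.
Proof. by apply: of_real_inj; rewrite of_realM !of_real_modulus normrM. Qed.

Lemma modulus_eq0 z : modulus z = 0 -> z = 0.
Proof.
by move=> z0; apply/normr0_eq0; rewrite -of_real_modulus z0 of_real0.
Qed.

Lemma modulus0 : modulus (0 : scalar_field R k) = 0.
Proof. by apply: of_real_inj; rewrite of_real_modulus normr0 of_real0. Qed.

End scalar_lemmas.

(* In a [tvsType] the uniform structure is only required to induce the
   topology, so completeness is expressed with an invariant metric. *)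
Definition frechet_space (R : realType) (k : scalar_kind)
    (X : tvsType (scalar_field R k)) : Prop :=
  exists d : X -> X -> R,
    [/\ (forall x y, d x y = 0 <-> x = y),
        (forall x y, d x y = d y x),
        (forall x y z, d x z <= d x y + d y z),
        (forall x y z, d (x + z) (y + z) = d x y) &
        (forall x (A : set X), nbhs x A <->
           exists2 e : R, 0 < e & [set y | d x y < e] `<=` A)
        /\ (forall u : nat -> X,
             (forall e : R, 0 < e -> exists N : nat, forall m n : nat,
               (N <= m)%N -> (N <= n)%N -> d (u m) (u n) < e) ->
             exists l : X, u @ \oo --> l)].

Definition infinite_dimensional (K : fieldType) (X : lmodType K) : Prop :=
  ~ exists (n : nat) (e : 'I_n -> X),
      forall x : X, exists c : 'I_n -> K, x = \sum_i c i *: e i.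

Inductive seq_kind (R : realType) :=
  | SeqC0
  | SeqLp (p : R) & 1 <= p.
Arguments SeqC0 {R}.

Section seq_space.
Context {R : realType} {k : scalar_kind}.
Local Notation K := (scalar_field R k).

Definition seq_mem (s : seq_kind R) : set (int -> K^o) :=
  match s with
  | SeqC0 => [set x | forall e : R, 0 < e -> exists N : nat,
      forall n : int, (N <= `|n|)%N -> modulus (x n) < e]
  | SeqLp p _ => [set x |
      (\esum_(n in [set: int]) (modulus (x n) `^ p)%:E < +oo)%E]
  end.

Definition seq_norm (s : seq_kind R) (x : int -> K^o) : R :=
  match s with
  | SeqC0 => sup [set modulus (x n) | n in [set: int]]
  | SeqLp p _ =>
      fine (\esum_(n in [set: int]) (modulus (x n) `^ p)%:E)%E `^ p^-1
  end.

(* [seq_bound s c x] states that the norm of x is at most c, see [seq_normP] *)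
Let seq_bound (s : seq_kind R) (c : R) (x : int -> K^o) : Prop :=
  match s with
  | SeqC0 => forall n, modulus (x n) <= c
  | SeqLp p _ => forall A : set int, finite_set A ->
      \sum_(n \in A) modulus (x n) `^ p <= c `^ p
  end.

Let lp_fsum (p : R) (x : int -> K^o) (A : set int) : finite_set A ->
  (\sum_(n \in A) (modulus (x n) `^ p)%:E)%E =
  (\sum_(n \in A) modulus (x n) `^ p)%:E.
Proof. by move=> fA; rewrite fsumEFin. Qed.

Let lp_bound_mem (p : R) (p1 : 1 <= p) (c : R) (x : int -> K^o) :
  seq_bound (SeqLp p1) c x ->
  (\esum_(n in [set: int]) (modulus (x n) `^ p)%:E <= (c `^ p)%:E)%E.
Proof.
move=> H; apply: ge_ereal_sup => _ [A [fA _] <-].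
by rewrite lp_fsum// lee_fin H.
Qed.

Let c0_bounded (x : int -> K^o) : seq_mem SeqC0 x ->
  exists2 c : R, 0 <= c & seq_bound SeqC0 c x.
Proof.
move=> /(_ 1 ltr01)[N xN].
suff [c c0 Hc] : exists2 c : R, 0 <= c &
    forall n : int, (`|n| < N)%N -> modulus (x n) <= c.
  exists (Num.max c 1); first by rewrite le_max c0.
  move=> n; rewrite le_max; case: (ltnP `|n| N) => [/Hc ->//|/xN /ltW ->].
  by rewrite orbT.
elim: {xN} N => [|N [c c0 Hc]]; first by exists 0.
exists (c + modulus (x N%:Z) + modulus (x (- N%:Z))).
  by rewrite !addr_ge0// modulus_ge0.
move=> n; rewrite ltnS leq_eqVlt => /orP[/eqP nN|/Hc nN].
  have /orP[/eqP->|/eqP->] : (n == N%:Z) || (n == - N%:Z).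
  - by move: nN; lia.
  - by rewrite addrAC lerDr addr_ge0// modulus_ge0.
  - by rewrite lerDr addr_ge0// modulus_ge0.
by rewrite -addrA (le_trans nN)// lerDl addr_ge0// modulus_ge0.
Qed.

Let seq_norm_ge0 s (x : int -> K^o) : 0 <= seq_norm s x.
Proof.
case: s => [|p p1] /=; last exact: powR_ge0.
have [h|h] := pselect (has_sup [set modulus (x n) | n in [set: int]]).
  apply: (le_trans (modulus_ge0 (x 0))).
  by apply: ub_le_sup; [case: h|exists 0].
by rewrite sup_out.
Qed.

Let seq_normP s c (x : int -> K^o) : seq_mem s x -> 0 <= c ->
  seq_norm s x <= c <-> seq_bound s c x.
Proof.
case: s => [|p p1] xs c0.
  split=> [/= xc n|xc].
    apply: le_trans xc; apply: ub_le_sup; last by exists n.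
    by have [M _ HM] := c0_bounded xs; exists M => _ [m _ <-]; exact: HM.
  by apply: ge_sup; [exists (modulus (x 0)), 0|move=> _ [m _ <-]; exact: xc].
have p0 : 0 < p by exact: lt_le_trans ltr01 p1.
set E := (\esum_(n in [set: int]) (modulus (x n) `^ p)%:E)%E.
have E0 : (0 <= E)%E by apply: esum_ge0 => n _; rewrite lee_fin powR_ge0.
have Efin : E \is a fin_num by rewrite ge0_fin_numE.
have -> : (seq_norm (SeqLp p1) x <= c) = (fine E <= c `^ p).
  have pK (a : R) : 0 <= a -> (a `^ p^-1) `^ p = a.
    by move=> a0; rewrite -powRrM mulVf ?gt_eqF// powRr1.
  rewrite -[in RHS](pK (fine E)) ?fine_ge0//= -/E.
  apply/idP/idP => [|h].
    by apply: ge0_ler_powR => //; rewrite ?nnegrE ?powR_ge0// ltW.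
  rewrite leNgt; apply/negP => /(gt0_ltr_powR p0); rewrite ltNge h.
  by rewrite !nnegrE powR_ge0 c0 => /(_ isT isT).
rewrite -lee_fin fineK//; split=> [H A fA|]; last exact: lp_bound_mem.
rewrite -lee_fin -lp_fsum// (le_trans _ H)//.
by apply: ereal_sup_ubound; exists A.
Qed.

Let seq_bound_norm s (x : int -> K^o) : seq_mem s x ->
  seq_bound s (seq_norm s x) x.
Proof. by move=> xs; apply/seq_normP => //; exact: seq_norm_ge0. Qed.

Let seq_bound_eq0 s (x : int -> K^o) : seq_bound s 0 x -> x = 0.
Proof.
case: s => [|p p1] x0; apply/funext => n; apply: modulus_eq0; apply/eqP.
  by rewrite eq_le modulus_ge0 x0.
have p0 : 0 < p by exact: lt_le_trans ltr01 p1.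
have := x0 _ (finite_set1 n).
rewrite fsbig_set1 powR0; last by rewrite gt_eqF.
move=> h.
by apply/eqP/(@powR_eq0_eq0 _ _ p)/eqP; rewrite eq_le h powR_ge0.
Qed.

Let seq_boundD s a b (x y : int -> K^o) : 0 <= a -> 0 <= b ->
  seq_bound s a x -> seq_bound s b y -> seq_bound s (a + b) (x + y).
Proof.
case: s => [|p p1] a0 b0 xa yb.
  by move=> n; rewrite (le_trans (modulusD _ _))// lerD.
have p0 : 0 < p by exact: lt_le_trans ltr01 p1.
have [a_eq0|a_neq0] := eqVneq a 0.
  move: xa; rewrite a_eq0 => /(@seq_bound_eq0 (SeqLp p1)) ->.
  by rewrite !add0r.
have [b_eq0|b_neq0] := eqVneq b 0.
  move: yb; rewrite b_eq0 => /(@seq_bound_eq0 (SeqLp p1)) ->.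
  by rewrite !addr0.
have {}a0 : 0 < a by rewrite lt0r a_neq0.
have {}b0 : 0 < b by rewrite lt0r b_neq0.
have ab0 : 0 < a + b by rewrite addr_gt0.
pose w := a / (a + b).
have w0 : 0 <= w by rewrite divr_ge0// ltW.
have w1 : w <= 1 by rewrite ler_pdivrMr// mul1r lerDl ltW.
have wb : 1 - w = b / (a + b).
  by rewrite /w -{1}(divff (lt0r_neq0 ab0)) -mulrBl addrAC subrr add0r.
move=> A fA.
pose g n := (a + b) `^ p * (w * (a^-1 `^ p * modulus (x n) `^ p)
                            + (1 - w) * (b^-1 `^ p * modulus (y n) `^ p)).
have le_g n : modulus ((x + y) n) `^ p <= g n.
  have -> : g n = (a + b) `^ p * (w * (modulus (x n) / a) `^ p
                            + (1 - w) * (modulus (y n) / b) `^ p).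
    rewrite /g -!powRM ?invr_ge0 ?modulus_ge0 ?(ltW a0) ?(ltW b0)//.
    by rewrite ![_^-1 * modulus _]mulrC.
  have xa0 : modulus (x n) / a \in (`[0, +oo[%classic : set R).
    by rewrite inE/= in_itv/= andbT divr_ge0 ?modulus_ge0// ltW.
  have yb0 : modulus (y n) / b \in (`[0, +oo[%classic : set R).
    by rewrite inE/= in_itv/= andbT divr_ge0 ?modulus_ge0// ltW.
  have cvx : (w * (modulus (x n) / a) + (1 - w) * (modulus (y n) / b)) `^ p <=
      w * (modulus (x n) / a) `^ p + (1 - w) * (modulus (y n) / b) `^ p.
    exact: (convex_powR p1 (Itv01 w0 w1) xa0 yb0).
  apply: le_trans (ler_wpM2l (powR_ge0 _ _) cvx).
  rewrite wb -powRM ?(ltW ab0)//; last first.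
    by rewrite addr_ge0// mulr_ge0// ?divr_ge0 ?modulus_ge0// ltW.
  apply: ge0_ler_powR; rewrite ?nnegrE ?modulus_ge0 ?(ltW p0)//.
    by rewrite mulr_ge0 ?(ltW ab0)// addr_ge0// mulr_ge0//
      ?divr_ge0 ?modulus_ge0// ltW.
  rewrite (le_trans (modulusD _ _))// /w.
  suff -> : (a + b) * (a / (a + b) * (modulus (x n) / a) +
     b / (a + b) * (modulus (y n) / b)) = modulus (x n) + modulus (y n) by [].
  by field; rewrite !gt_eqF.
apply: (@le_trans _ _ (\sum_(n \in A) g n)).
  by rewrite !fsbig_finite//=; apply: ler_sum => n _; exact: le_g.
have -> : \sum_(n \in A) g n = (a + b) `^ p * (
    w * (a^-1 `^ p * \sum_(n \in A) modulus (x n) `^ p) +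
    (1 - w) * (b^-1 `^ p * \sum_(n \in A) modulus (y n) `^ p)).
  rewrite !fsbig_finite//= !mulr_sumr -big_split/= mulr_sumr.
  by apply: eq_bigr.
have unit_le c z : 0 < c -> seq_bound (SeqLp p1) c z ->
    c^-1 `^ p * \sum_(n \in A) modulus (z n) `^ p <= 1.
  move=> c0 zc; apply: (@le_trans _ _ (c^-1 `^ p * c `^ p)).
    by rewrite ler_wpM2l ?powR_ge0// zc.
  rewrite -powRM ?invr_ge0 ?(ltW c0)//.
  by rewrite mulVf ?powR1 ?gt_eqF.
rewrite -[leRHS]mulr1 ler_wpM2l ?powR_ge0//.
rewrite -[leRHS](subrKC w) lerD//.
  by rewrite -[leRHS]mulr1 ler_wpM2l// unit_le.
by rewrite -[leRHS]mulr1 ler_wpM2l ?subr_ge0// unit_le.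
Qed.

Let seq_boundZ s c l (x : int -> K^o) : 0 <= c ->
  seq_bound s c x -> seq_bound s (modulus l * c) (l *: x).
Proof.
case: s => [|p p1] c0 xc.
  by move=> n; rewrite modulusM ler_wpM2l ?modulus_ge0.
move=> A fA; rewrite powRM ?modulus_ge0//.
have -> : \sum_(n \in A) modulus ((l *: x) n) `^ p =
    modulus l `^ p * \sum_(n \in A) modulus (x n) `^ p.
  rewrite !fsbig_finite//= mulr_sumr; apply: eq_bigr => n _.
  by rewrite modulusM powRM ?modulus_ge0.
by rewrite ler_wpM2l ?powR_ge0// xc.
Qed.

Definition seq_pred (s : seq_kind R) : {pred int -> K^o} := mem (seq_mem s).

Lemma seq_pred_submod s : submod_closed (seq_pred s).
Proof.
split.
  rewrite inE; case: s => [|p p1] /=.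
    by move=> e e0; exists 0%N => n _; rewrite modulus0.
  rewrite esum1 ?ltry// => n _.
  by rewrite modulus0 powR0// gt_eqF// (lt_le_trans _ p1).
move=> l x y /[!inE] xs ys.
case: s xs ys => [|p p1] xs ys.
  move=> e e0.
  have l0 : 0 < modulus l + 1 by rewrite ltr_wpDl ?modulus_ge0.
  have [|N HN] := xs (e / 2 / (modulus l + 1)); first by rewrite !divr_gt0.
  have [|M HM] := ys (e / 2); first by rewrite divr_gt0.
  exists (maxn N M) => n; rewrite geq_max => /andP[/HN xn /HM yn].
  rewrite (le_lt_trans (modulusD _ _))// [ltRHS]splitr ler_ltD//.
  rewrite modulusM; move: xn; rewrite ltr_pdivlMr// mulrC => /ltW.
  by apply: le_trans; rewrite ler_wpM2r ?modulus_ge0// lerDl.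
have lx := seq_boundZ l (seq_norm_ge0 _ _) (seq_bound_norm xs).
have := seq_boundD _ _ lx (seq_bound_norm ys).
rewrite mulr_ge0 ?modulus_ge0 ?seq_norm_ge0//.
move=> /(_ isT isT)/lp_bound_mem/le_lt_trans; apply; exact: ltry.
Qed.

Let seq_memD s (x y : int -> K^o) : seq_mem s x -> seq_mem s y ->
  seq_mem s (x + y).
Proof.
move=> /mem_set xs /mem_set ys; apply/set_mem.
by have [_ /(_ 1 x y xs ys)] := seq_pred_submod s; rewrite scale1r.
Qed.

Let seq_memZ s l (x : int -> K^o) : seq_mem s x -> seq_mem s (l *: x).
Proof.
move=> /mem_set xs; apply/set_mem; have [s0 sl] := seq_pred_submod s.
by have := sl l x 0 xs s0; rewrite addr0.
Qed.

Lemma seq_normD s (x y : int -> K^o) : seq_mem s x -> seq_mem s y ->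
  seq_norm s (x + y) <= seq_norm s x + seq_norm s y.
Proof.
move=> xs ys; apply/seq_normP; first exact: seq_memD.
  by rewrite addr_ge0 ?seq_norm_ge0.
by apply: seq_boundD; rewrite ?seq_norm_ge0//; exact: seq_bound_norm.
Qed.

Lemma seq_norm_eq0 s (x : int -> K^o) : seq_mem s x ->
  seq_norm s x = 0 -> x = 0.
Proof.
by move=> xs x0; apply: (@seq_bound_eq0 s); rewrite -x0; exact: seq_bound_norm.
Qed.

Lemma seq_normZ s l (x : int -> K^o) : seq_mem s x ->
  seq_norm s (l *: x) = modulus l * seq_norm s x.
Proof.
have le_normZ (t : K) z : seq_mem s z ->
    seq_norm s (t *: z) <= modulus t * seq_norm s z.
  move=> zs; apply/seq_normP; first exact: seq_memZ.
    by rewrite mulr_ge0 ?modulus_ge0 ?seq_norm_ge0.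
  by apply: seq_boundZ; [exact: seq_norm_ge0|exact: seq_bound_norm].
move=> xs; apply/eqP; rewrite eq_le le_normZ//=.
have [->|l0] := eqVneq l 0; first by rewrite modulus0 mul0r seq_norm_ge0.
have ml0 : 0 < modulus l.
  by rewrite lt0r modulus_ge0 andbT; apply: contra_neq l0; exact: modulus_eq0.
have := le_normZ l^-1 _ (seq_memZ l xs).
rewrite scalerA mulVf// scale1r => /(ler_wpM2l (ltW ml0)).
rewrite mulrA -modulusM mulfV//.
suff -> : modulus (1 : K) = 1 by rewrite mul1r.
by apply: (@of_real_inj R k); rewrite of_real_modulus normr1; case: (k).
Qed.

End seq_space.

Record seq_space (R : realType) (k : scalar_kind) (s : seq_kind R) := SeqSpace {
  seq_val :> int -> (scalar_field R k)^o;
  seq_valP : seq_val \in seq_pred s }.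

Section seq_space_normed.
Context (R : realType) (k : scalar_kind) (s : seq_kind R).
Local Notation K := (scalar_field R k).
Local Notation V := (seq_space k s).

HB.instance Definition _ := GRing.isSubmodClosed.Build _ _
  (seq_pred (k := k) s) (seq_pred_submod s).
HB.instance Definition _ := [isSub for @seq_val R k s].
HB.instance Definition _ := [Choice of V by <:].
HB.instance Definition _ := [SubChoice_isSubLmodule of V by <:].

Let norm (x : V) : K := of_real (seq_norm s x).

Let normD x y : norm (x + y) <= norm x + norm y.
Proof.
by rewrite -of_realD ler_of_real seq_normD//; apply/set_mem/seq_valP.
Qed.

Let normZ l x : norm (l *: x) = `|l| * norm x.
Proof.
by rewrite -of_real_modulus -of_realM /norm seq_normZ//; apply/set_mem/seq_valP.
Qed.

Let norm_eq0 x : norm x = 0 -> x = 0.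
Proof.
rewrite -of_real0 => /of_real_inj x0; apply: val_inj => /=.
by apply: (seq_norm_eq0 _ x0); apply/set_mem/seq_valP.
Qed.

HB.instance Definition _ := Lmodule_isNormed.Build K V normD normZ norm_eq0.

End seq_space_normed.

(* [S] is B_w for some bounded sequence [w] of positive reals; B_w is given as
   a property of [S] because its values must be shown to lie in the space *)
Definition bilateral_weighted_backward_shift (R : realType) (k : scalar_kind)
    (s : seq_kind R) (S : seq_space k s -> seq_space k s) : Prop :=
  exists w : int -> R,
    [/\ forall n, 0 < w n,
        exists M : R, forall n, w n <= M &
        forall (x : seq_space k s) (n : int),
          S x n = of_real (w (n + 1)) * x (n + 1)].

(* Main.v *)
(** (1) => (2): fullness allows one to drop finitely many elements from a member
    of [F], so Furstenberg's trick shows that the hitting sets of an F-mixing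
    [S] form a filter base contained in [tilde F]; hence they meet those of [T],
    the direct sum is topologically transitive, and Birkhoff's theorem applies.
    (2) => (3): [Y] is a separable infinite-dimensional Banach space.
    (3) => (1): given [A] in [tilde F], let [g m] be the distance from the
    integer [m] to the set of the [z] such that [z = 0] or [|z|] is not in [A].
    The backward shift with weights [2 ^ (g n - g (n - 1))] is invertible as [g]
    is 1-Lipschitz; it is F-mixing as [g] is large at [n] and [- n] whenever
    [A] contains a long interval around [n]; and for suitable balls all its
    hitting times [n] satisfy [g n > 0], so they lie in [A]. *)

From HB Require Import structures.
Require Import Defs.
From mathcomp Require Import all_boot all_order all_algebra.
From mathcomp Require Import complex zify.
From mathcomp Require Import all_classical all_reals all_analysis.

Set Implicit Arguments.
Unset Strict Implicit.
Unset Printing Implicit Defensive.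

Import Order.TTheory GRing.Theory Num.Theory.
Import numFieldTopology.Exports numFieldNormedType.Exports.
Local Open Scope classical_set_scope.
Local Open Scope ring_scope.

(** * Furstenberg families and F-mixing operators *)

Section furstenberg_families.
Variable F : set (set nat).
Hypothesis F_family : furstenberg_family F.

Lemma family_nonempty A : F A -> A !=set0.
Proof.
case: F_family => _ _ F0 FA; apply/set0P/eqP => A0; apply: F0.
by rewrite -A0.
Qed.

Lemma family_sub A B : A `<=` B -> F A -> F B.
Proof. by case: F_family => up _ _ AB FA; apply: (up A). Qed.

Lemma dual_setC A : ~ F A -> dual_family F (~` A).
Proof.
move=> nFA B FB; apply: contrapT => BA; apply/nFA/(family_sub _ FB) => n Bn.
by apply: contrapT => An; apply: BA; exists n.
Qed.

(** If the tail were outside [F], its complement would lie in the dual family, and fullness would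
    make that complement meet [A] in an infinite set; but it meets [A] only below [k]. *)
Lemma full_family_tail A k : full_family F -> F A ->
  F (A `&` [set n | (k <= n)%N]).
Proof.
move=> F_full FA; apply: contrapT => /dual_setC /(F_full _ _ FA); apply.
apply: (@sub_finite_set _ _ `I_k) (finite_II k) => n [An nAn] /=.
by rewrite ltnNge; apply/negP => kn; apply: nAn.
Qed.

End furstenberg_families.

Section hitting.
Variable M : topologicalType.
Variable S : M -> M.

Lemma hitting_timesP (U V : set M) n :
  hitting_times S U V n <-> exists2 x, U x & V (iter n S x).
Proof.
split=> [[_ [[x Ux <-] Vx]]|[x Ux Vx]]; first by exists x.
by exists (iter n S x); split => //; exists x.
Qed.

Lemma continuous_iter n : continuous S -> continuous (iter n S).
Proof.
move=> cS; elim: n => [|n IHn] x; first exact: cvg_id.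
by apply: (continuous_comp (IHn x)); exact: cS.
Qed.

Lemma open_preimage_iter n (U : set M) : continuous S -> open U ->
  open (iter n S @^-1` U).
Proof.
by move=> cS oU; apply: open_comp => // x _; exact: continuous_iter.
Qed.

Definition hitting_filter : set (set nat) :=
  [set A | exists U V : set M, [/\ open U, open V, U !=set0, V !=set0 &
     hitting_times S U V `<=` A]].

End hitting.

Lemma iter_direct_sum (M N : topologicalType) (T : M -> M) (S : N -> N) n z :
  iter n (direct_sum T S) z = (iter n T z.1, iter n S z.2).
Proof. by elim: n => [|n /= ->]; [case: z|]. Qed.

Lemma continuous_direct_sum (M N : topologicalType) (T : M -> M) (S : N -> N) :
  continuous T -> continuous S -> continuous (direct_sum T S).
Proof.
move=> cT cS z; apply: cvg_pair => /=.
  by apply: (@continuous_comp _ _ _ fst T); [exact: cvg_fst|exact: cT].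
by apply: (@continuous_comp _ _ _ snd S); [exact: cvg_snd|exact: cS].
Qed.

Lemma open_rect (M N : topologicalType) (U : set M) (V : set N) :
  open U -> open V -> open (U `*` V).
Proof.
move=> oU oV; rewrite openE => z [Uz Vz].
by exists (U, V) => //; split; exact: open_nbhs_nbhs.
Qed.

Lemma open_rect_sub (M N : topologicalType) (W : set (M * N)) z :
  open W -> W z -> exists U V, [/\ open U, open V, U z.1, V z.2 & U `*` V `<=` W].
Proof.
move=> oW Wz; have [[A B] /= [Az Bz] AB] : nbhs z W by exact: open_nbhs_nbhs.
exists A°, B°; split; [exact: open_interior|exact: open_interior|by []|by []|].
by move=> y [/= /interior_subset Ay /interior_subset By]; exact: AB.
Qed.

(** * Hitting sets of F-mixing maps *)

Section mixing.
Variables (F : set (set nat)) (M : topologicalType) (S : M -> M).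
Hypotheses (F_family : furstenberg_family F) (F_full : full_family F).
Hypotheses (S_continuous : continuous S) (S_mixing : family_mixing F S).

Lemma mixing_hitting2 (U1 V1 U2 V2 : set M) :
  open U1 -> open V1 -> open U2 -> open V2 ->
  U1 !=set0 -> V1 !=set0 -> U2 !=set0 -> V2 !=set0 ->
  F (hitting_times S U1 V1 `&` hitting_times S U2 V2).
Proof.
move=> oU1 oV1 oU2 oV2 [u1 ?] [v1 ?] [u2 ?] [v2 ?].
apply: (family_sub F_family _ (S_mixing (open_rect oU1 oU2) (open_rect oV1 oV2) _ _)).
- move=> n /hitting_timesP[[x1 x2] [/= ? ?]]; rewrite iter_direct_sum => -[/= ? ?].
  by split; apply/hitting_timesP; [exists x1|exists x2].
- by exists (u1, u2).
- by exists (v1, v2).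
Qed.

Lemma mixing_transitive : family_transitive F S.
Proof.
move=> U V oU oV U0 V0.
by apply: (family_sub F_family _ (mixing_hitting2 oU oV oU oV U0 V0 U0 V0)) => n [].
Qed.

Lemma hitting_filter_family A : hitting_filter S A -> F A.
Proof.
move=> [U [V [oU oV U0 V0 UV]]]; apply: (family_sub F_family UV).
exact: mixing_transitive.
Qed.

(* Furstenberg's argument: a common hitting time [n] of (U1, U2) and (V1, V2)
   lets the pair (U1 cap S^-n U2, V1 cap S^-n V2) serve both given pairs,
   because the powers of [S] commute. *)
Lemma hitting_filterI A B :
  hitting_filter S A -> hitting_filter S B -> hitting_filter S (A `&` B).
Proof.
move=> [U1 [V1 [oU1 oV1 U10 V10 sA]]] [U2 [V2 [oU2 oV2 U20 V20 sB]]].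
have [n []] := family_nonempty F_family
  (mixing_hitting2 oU1 oU2 oV1 oV2 U10 U20 V10 V20).
move=> /hitting_timesP[u U1u U2u] /hitting_timesP[v V1v V2v].
exists (U1 `&` iter n S @^-1` U2), (V1 `&` iter n S @^-1` V2).
split; [|by apply: openI => //; exact: open_preimage_iter|by exists u|by exists v|].
  by apply: openI => //; exact: open_preimage_iter.
move=> m /hitting_timesP[x [U1x U2x] [V1x V2x]]; split.
  by apply/sA/hitting_timesP; exists x.
apply/sB/hitting_timesP; exists (iter n S x) => //.
by move: V2x; rewrite /preimage /= -!iterD addnC.
Qed.

Lemma hitting_filter_forall (A : nat -> set nat) k :
  (forall i, hitting_filter S (A i)) ->
  hitting_filter S [set n | forall i, (i <= k)%N -> A i n].
Proof.
move=> AS; elim: k => [|k IHk].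
  have [U [V [? ? ? ? UV]]] := AS 0%N.
  by exists U, V; split=> // n /UV A0n i; rewrite leqn0 => /eqP ->.
have [U [V [? ? ? ? UV]]] := hitting_filterI IHk (AS k.+1).
exists U, V; split=> // n /UV[An Ak1 i].
by rewrite leq_eqVlt => /orP[/eqP ->//|]; rewrite ltnS; exact: An.
Qed.

Lemma hitting_times_filter U V : open U -> open V -> U !=set0 -> V !=set0 ->
  hitting_filter S (hitting_times S U V).
Proof. by move=> *; exists U, V; split. Qed.

(** By fullness the hitting times of [[set: M]] and [U] include some [m >= n]; if [iter m S x] lies
    in [U], then [iter (m - n) S x] is a point of the preimage. *)
Lemma preimage_iter_nonempty n U : open U -> U !=set0 ->
  iter n S @^-1` U !=set0.
Proof.
move=> oU U0; have [x0 Ux0] := U0.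
have T0 : [set: M] !=set0 by exists x0.
have := mixing_transitive openT oU T0 U0.
move=> /(full_family_tail F_family n F_full)/(family_nonempty F_family).
move=> [m [/hitting_timesP[x _ Ux] nm]]; exists (iter (m - n) S x).
by rewrite /preimage /= -iterD subnKC.
Qed.

(** A translated hitting set is governed by preimages: if [n] is a hitting time of [S^-i U] and [V],
    then [n - i] is one of [U] and [V]; if [n] is a hitting time of [U] and [S^-i V], then [n + i]
    is one of [U] and [V]. The filter property treats all [i <= k] at once. *)
Lemma mixing_tilde_transitive : family_transitive (tilde_family F) S.
Proof.
move=> U V oU oV U0 V0; split; first exact: mixing_transitive.
move=> k; set D := [set n | forall i, (i <= k)%N ->
  (hitting_times S (iter i S @^-1` U) V `&`
   hitting_times S U (iter i S @^-1` V)) n].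
have FD : F D.
  apply/hitting_filter_family/hitting_filter_forall => i.
  apply: hitting_filterI; apply: hitting_times_filter => //;
    by [exact: open_preimage_iter|exact: preimage_iter_nonempty].
(* Restricting to [n >= k] keeps the natural number subtraction [n - i] from truncating. *)
apply: (family_sub F_family _ (full_family_tail F_family k F_full FD)).
move=> n [Dn /= kn] i /= /andP[ik1 ik2].
have /Dn[/hitting_timesP[x Ux Vx] /hitting_timesP[y Uy Vy]] : (`|i| <= k)%N by lia.
have [i0|i0] := leP 0 i.
- exists (n - `|i|)%N; last by lia.
  apply/hitting_timesP; exists (iter `|i| S x) => //.
  by rewrite -iterD subnK//; lia.
- exists (n + `|i|)%N; last by lia.
  by apply/hitting_timesP; exists y => //; rewrite addnC iterD.
Qed.

End mixing.

(** * Birkhoff's transitivity theorem *)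

(** The metric content of a Fréchet space, stated without its linear structure so that the category
    argument runs on arbitrary spaces. *)
Definition complete_metric (R : realType) (M : topologicalType)
    (d : M -> M -> R) : Prop :=
  [/\ (forall x, d x x = 0), (forall x y, d x y = d y x),
      (forall x y z, d x z <= d x y + d y z),
      (forall x (A : set M), nbhs x A <->
         exists2 e : R, 0 < e & [set y | d x y < e] `<=` A) &
      (forall u : nat -> M,
         (forall e : R, 0 < e -> exists N : nat, forall m n : nat,
           (N <= m)%N -> (N <= n)%N -> d (u m) (u n) < e) ->
         exists l : M, u @ \oo --> l)].

Lemma frechet_complete_metric (R : realType) (k : scalar_kind)
    (X : tvsType (scalar_field R k)) :
  frechet_space X -> exists d : X -> X -> R, complete_metric d.
Proof.
move=> [d [d0 dC dt _ [dn dc]]]; exists d; split => // x.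
by apply/d0.
Qed.

Section metric.
Variables (R : realType) (M : topologicalType) (d : M -> M -> R).
Hypothesis dM : complete_metric d.

Lemma metric_ge0 x y : 0 <= d x y.
Proof.
case: dM => d0 dC dt _ _; have := dt x y x; rewrite d0 (dC y x).
by rewrite -mulr2n pmulrn_lge0.
Qed.

Lemma metric_ball_open x (r : R) : open [set y | d x y < r].
Proof.
case: dM => d0 dC dt dn _; rewrite openE => y /= xy; apply/dn.
exists (r - d x y); first by rewrite subr_gt0.
by move=> z /= yz; rewrite (le_lt_trans (dt _ y _))// -ltrBrDl.
Qed.

Lemma metric_open_ball (U : set M) x : open U -> U x ->
  exists2 e : R, 0 < e & [set y | d x y < e] `<=` U.
Proof. by case: dM => _ _ _ dn _ oU Ux; apply/dn; exact: open_nbhs_nbhs. Qed.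

Lemma metric_cvg (u : nat -> M) l : u @ \oo --> l ->
  forall e : R, 0 < e -> exists N, forall n, (N <= n)%N -> d l (u n) < e.
Proof.
case: dM => _ _ _ dn _ ul e e0.
have /ul[N _ Nu] : nbhs l [set y | d l y < e] by apply/dn; exists e.
by exists N => n Nn; exact: Nu.
Qed.

End metric.

Lemma complete_metric_prod (R : realType) (M N : topologicalType)
    (d : M -> M -> R) (d' : N -> N -> R) :
  complete_metric d -> complete_metric d' ->
  complete_metric (fun x y : M * N => d x.1 y.1 + d' x.2 y.2).
Proof.
move=> dM dN; have [d0 dC dt dn dc] := dM; have [d'0 d'C d't d'n d'c] := dN.
split=> [x|x y|x y z|x A|u ucauchy].
- by rewrite d0 d'0 addr0.
- by rewrite dC d'C.
- by rewrite addrACA lerD.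
- split=> [[[B C] /= [/dn[e e0 eB] /d'n[e' e'0 eC]] BC]|[e e0 eA]].
    exists (Num.min e e'); first by rewrite lt_min e0.
    move=> y /=; rewrite lt_min => /andP[ye ye']; apply: BC; split => /=.
      by apply/eB/(le_lt_trans _ ye); rewrite lerDl (metric_ge0 dN).
    by apply/eC/(le_lt_trans _ ye'); rewrite lerDr (metric_ge0 dM).
  exists ([set y | d x.1 y < e / 2], [set y | d' x.2 y < e / 2]) => /=.
    by split; [apply/dn|apply/d'n]; exists (e / 2) => //; rewrite divr_gt0.
  by move=> y [/= y1 y2]; apply: eA; rewrite /= [ltRHS]splitr ltrD.
- have [|l1 ul1] := dc (fst \o u).
    move=> e /ucauchy[n nu]; exists n => i j ni nj.
    by apply: le_lt_trans (nu i j ni nj); rewrite lerDl (metric_ge0 dN).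
  have [|l2 ul2] := d'c (snd \o u).
    move=> e /ucauchy[n nu]; exists n => i j ni nj.
    by apply: le_lt_trans (nu i j ni nj); rewrite lerDr (metric_ge0 dM).
  exists (l1, l2).
  have -> : u = fun n => ((u n).1, (u n).2) by apply/funext => n; case: (u n).
  exact: cvg_pair.
Qed.

Lemma separable_prod (M N : topologicalType) :
  separable_space M -> separable_space N -> separable_space (M * N)%type.
Proof.
move=> [A [cA dA]] [B [cB dB]]; exists (A `*` B); split; first exact: countableX.
move=> W [z Wz] oW; have [U [V [oU oV Uz Vz UV]]] := open_rect_sub oW Wz.
have [a [Ua Aa]] : U `&` A !=set0 by apply: dA => //; exists z.1.
have [b [Vb Bb]] : V `&` B !=set0 by apply: dB => //; exists z.2.
by exists (a, b); split; [exact: UV|].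
Qed.

(* Birkhoff: the points visiting the [m]-th ball of a countable base form a
   dense open set; the Baire argument is run along nested closed balls. *)
Lemma transitive_hypercyclic (R : realType) (M : topologicalType)
    (d : M -> M -> R) (f : M -> M) (x0 : M) :
  complete_metric d -> separable_space M -> continuous f ->
  (forall U V, open U -> open V -> U !=set0 -> V !=set0 ->
     hitting_times f U V !=set0) ->
  hypercyclic f.
Proof.
move=> dM [D [/countable_injP[g g_inj] dD]] cf ft.
have [d0 dC dt dn dc] := dM.
(* [m] codes a pair [(i, j)]; [base m] is the ball of radius [1/(j+1)] about the point of [D]
   numbered [i], and is empty if there is no such point. *)
pose base (m : nat) : set M :=
  let ij := odflt (0%N, 0%N) (unpickle m) in
  [set y | exists a, [/\ D a, g a = ij.1 & d a y < ij.2.+1%:R^-1]].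
have base_open m : open (base m).
  rewrite openE => y [a [Da ga ya]].
  have := open_nbhs_nbhs (conj (metric_ball_open dM a _) ya).
  by apply: filterS => z /= za; exists a.
pose step (m : nat) (p q : M * R) := [/\ 0 < q.2, q.2 <= m.+1%:R^-1,
  [set z | d q.1 z <= q.2] `<=` [set z | d p.1 z < p.2] &
  base m !=set0 -> forall z, d q.1 z <= q.2 -> exists n, base m (iter n f z)].
(* The radius condition sits under the existential so that [choice] yields a total function; for a
   nonpositive radius any pair will do. *)
have step_ex (mp : nat * (M * R)) : exists q, 0 < mp.2.2 -> step mp.1 mp.2 q.
  case: mp => m [x r] /=; have [r0|] := boolP (0 < r); last by exists (x, r).
  have ballx : [set z | d x z < r] !=set0 by exists x; rewrite /= d0.
  have [W [y [oW Wy Wx Wm]]] : exists W y, [/\ open W, W y,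
      W `<=` [set z | d x z < r] &
      base m !=set0 -> forall z, W z -> exists n, base m (iter n f z)].
    have [b0|b0] := pselect (base m !=set0); last first.
      exists [set z | d x z < r], x; split => //=; last by rewrite d0.
      exact: metric_ball_open dM _ _.
    have [n /hitting_timesP[y xy by_]] :=
      ft _ _ (metric_ball_open dM x r) (base_open m) ballx b0.
    exists ([set z | d x z < r] `&` iter n f @^-1` base m), y.
    split=> [||z []//|_ z [_ zb]]; [|by []|by exists n].
    by apply: openI; [exact: metric_ball_open dM _ _|exact: open_preimage_iter].
  have [e e0 eW] := metric_open_ball dM oW Wy.
  (* Halving [e] places the closed ball inside the open ball of radius [e]; the bound [1/(m+1)]
     makes the radii tend to 0. *)
  exists (y, Num.min (e / 2) m.+1%:R^-1) => _; split => /=.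
  - by rewrite lt_min divr_gt0//= invr_gt0.
  - by rewrite ge_min lexx orbT.
  - move=> z /=; rewrite le_min => /andP[ze _]; apply/Wx/eW => /=.
    by rewrite (le_lt_trans ze)// ltr_pdivrMr// ltr_pMr// ltr1n.
  - move=> b0 z; rewrite le_min => /andP[ze _]; apply: Wm => //; apply: eW => /=.
    by rewrite (le_lt_trans ze)// ltr_pdivrMr// ltr_pMr// ltr1n.
have [next nextP] := choice step_ex.
pose fix s n : M * R := if n is m.+1 then next (m, s m) else (x0, 1).
have s_gt0 n : 0 < (s n).2.
  by elim: n => [|n IHn] /=; [exact: ltr01|case: (nextP (n, s n) IHn)].
have s_step n : step n (s n) (s n.+1) by apply: (nextP (n, s n)); exact: s_gt0.
have s_nested m n : (m <= n)%N ->
    [set z | d (s n).1 z <= (s n).2] `<=` [set z | d (s m).1 z <= (s m).2].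
  elim: n => [|n IHn]; first by rewrite leqn0 => /eqP ->.
  rewrite leq_eqVlt => /orP[/eqP ->//|/IHn mn].
  apply: subset_trans mn => z zn; have [_ _ sub _] := s_step n.
  exact/ltW/sub.
have s_in m n : (m <= n)%N -> d (s m).1 (s n).1 <= (s m).2.
  by move=> mn; apply: (s_nested _ _ mn) => /=; rewrite d0 ltW.
(* From index [N + 1] on, all centres lie within [1/(N+1) < e/2] of the centre with that index. *)
have [|l sl] := dc (fun n => (s n).1).
  move=> e e0; have [N Ne] : exists N : nat, N.+1%:R^-1 < e / 2.
    exists (Num.truncn (e / 2)^-1); rewrite invf_plt ?posrE ?divr_gt0//.
    exact: truncnS_gt.
  exists N.+1 => m n Nm Nn; rewrite (le_lt_trans (dt _ (s N.+1).1 _))//.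
  have [_ rN _ _] := s_step N; have re := le_lt_trans rN Ne.
  by rewrite [ltRHS]splitr ltrD// ?(dC _ (s N.+1).1) (le_lt_trans (s_in _ _ _) re).
have l_in m : d (s m).1 l <= (s m).2.
  apply/ler_addgt0Pr => e e0; have [N Nl] := metric_cvg dM sl e0.
  rewrite (le_trans (dt _ (s (maxn m N)).1 _))// lerD//.
    by apply: s_in; exact: leq_maxl.
  by rewrite dC; apply/ltW/Nl; exact: leq_maxr.
exists l => W [y Wy] oW; have [e e0 eW] := metric_open_ball dM oW Wy.
have [j je] : exists j : nat, j.+1%:R^-1 < e / 2.
  exists (Num.truncn (e / 2)^-1); rewrite invf_plt ?posrE ?divr_gt0//.
  exact: truncnS_gt.
(* A basic ball about a point [a] of [D] close to [y] is visited by the orbit of [l]; both distances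
   to [a] are below [e/2]. *)
have [a [/= ya Da]] : [set z | d y z < j.+1%:R^-1] `&` D !=set0.
  apply: dD; last exact: metric_ball_open dM _ _.
  by exists y; rewrite /= d0 invr_gt0.
have base_aj : base (pickle (g a, j)) a.
  by exists a; rewrite pickleK /= d0 invr_gt0.
have [_ _ _ visit] := s_step (pickle (g a, j)).
have [n [a' []]] := visit (ex_intro _ _ base_aj) l (l_in _).
rewrite pickleK /= => Da' ga' la'.
(* The basic set records only the number of its centre; injectivity of [g] on [D] recovers the
   centre. *)
have a'a : a' = a by apply: g_inj; rewrite ?inE.
exists (iter n f l); split; last by exists n.
apply: eW => /=; rewrite (le_lt_trans (dt _ a _))// [ltRHS]splitr ltrD//.
  exact: lt_trans je.
by rewrite -a'a; exact: lt_trans je.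
Qed.

(** On rectangles the hitting times of the direct sum are the common hitting times of [T] and [S];
    one set lies in the dual of [tilde_family F] and the other in [tilde_family F], so they meet. *)
Lemma dual_tilde_transitive_weakly_disjoint (R : realType) (k : scalar_kind)
    (X Z : tvsType (scalar_field R k)) (F : set (set nat))
    (T : X -> X) (S : Z -> Z) :
  frechet_space X -> separable_space X -> frechet_space Z -> separable_space Z ->
  furstenberg_family F -> full_family F -> continuous T -> continuous S ->
  family_transitive (dual_family (tilde_family F)) T -> family_mixing F S ->
  weakly_disjoint T S.
Proof.
move=> /frechet_complete_metric[d dX] sX /frechet_complete_metric[d' dZ] sZ.
move=> F_family F_full cT cS Ttrans Smix.
apply: (transitive_hypercyclic (0, 0) (complete_metric_prod dX dZ)).
- exact: separable_prod.
- exact: continuous_direct_sum.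
move=> U V oU oV [u Uu] [v Vv].
have [U1 [U2 [oU1 oU2 U1u U2u U12]]] := open_rect_sub oU Uu.
have [V1 [V2 [oV1 oV2 V1v V2v V12]]] := open_rect_sub oV Vv.
have NT : dual_family (tilde_family F) (hitting_times T U1 V1).
  by apply: Ttrans => //; [exists u.1|exists v.1].
have NS : tilde_family F (hitting_times S U2 V2).
  by apply: mixing_tilde_transitive => //; [exists u.2|exists v.2].
have [n [/hitting_timesP[x Ux Vx] /hitting_timesP[y Uy Vy]]] := NT _ NS.
exists n; apply/hitting_timesP; exists (x, y); first exact: U12.
by rewrite iter_direct_sum; exact: V12.
Qed.

(** * Sequence spaces *)

Section modulus_theory.
Context {R : realType} {k : scalar_kind}.
Local Notation K := (scalar_field R k).

Lemma of_real1 : of_real 1 = 1 :> K.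
Proof. by case: k. Qed.

Lemma modulus_of_real r : 0 <= r -> modulus (of_real r : K) = r.
Proof.
move=> r0; apply: (@of_real_inj R k).
by rewrite of_real_modulus ger0_norm// -of_real0 ler_of_real.
Qed.

Lemma modulus1 : modulus (1 : K) = 1.
Proof. by rewrite -of_real1 modulus_of_real. Qed.

Lemma modulusN (z : K) : modulus (- z) = modulus z.
Proof. by apply: (@of_real_inj R k); rewrite !of_real_modulus normrN. Qed.

End modulus_theory.

Lemma modulus_Re_Im {R : realType} (z : scalar_field R ComplexScalars) :
  modulus z <= `|complex.Re z| + `|complex.Im z|.
Proof.
case: z => a b /=.
rewrite -[leRHS]ger0_norm ?addr_ge0// -sqrtr_sqr ler_wsqrtr//.
rewrite sqrrD !real_normK ?num_real// addrAC lerDl.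
by rewrite mulrn_wge0// mulr_ge0.
Qed.

Lemma Re_le_modulus {R : realType} (z : scalar_field R ComplexScalars) :
  `|complex.Re z| <= modulus z.
Proof. by case: z => a b /=; rewrite -sqrtr_sqr ler_wsqrtr// lerDl sqr_ge0. Qed.

Lemma Im_le_modulus {R : realType} (z : scalar_field R ComplexScalars) :
  `|complex.Im z| <= modulus z.
Proof. by case: z => a b /=; rewrite -sqrtr_sqr ler_wsqrtr// lerDr sqr_ge0. Qed.

Lemma real_cauchy_limit (R : realType) (u : nat -> R) :
  (forall e : R, 0 < e -> exists N, forall m n,
     (N <= m)%N -> (N <= n)%N -> `|u m - u n| < e) ->
  exists l, forall e : R, 0 < e -> exists N, forall n, (N <= n)%N ->
    `|u n - l| < e.
Proof.
move=> uc; have /cauchy_cvgP/cvg_ex[l ul] : cauchy (u @ \oo).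
  apply/cauchy_exP => e /uc[N Nu]; exists (u N), N => // n Nn.
  exact: Nu.
exists l => e e0; have /cvgrPdist_lt/(_ e e0)[N _ Nu] := ul.
by exists N => n /Nu; rewrite distrC.
Qed.

Lemma scalar_cauchy_limit (R : realType) (k : scalar_kind)
    (u : nat -> scalar_field R k) :
  (forall e : R, 0 < e -> exists N, forall m n,
     (N <= m)%N -> (N <= n)%N -> modulus (u m - u n) < e) ->
  exists l, forall e : R, 0 < e -> exists N, forall n, (N <= n)%N ->
    modulus (u n - l) < e.
Proof.
case: k u => u uc; first exact: real_cauchy_limit.
have [|a ua] := @real_cauchy_limit R (fun n => complex.Re (u n)).
  move=> e /uc[N Nu]; exists N => m n Nm Nn.
  by apply: le_lt_trans (Nu m n Nm Nn); rewrite -raddfB; exact: Re_le_modulus.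
have [|b ub] := @real_cauchy_limit R (fun n => complex.Im (u n)).
  move=> e /uc[N Nu]; exists N => m n Nm Nn.
  by apply: le_lt_trans (Nu m n Nm Nn); rewrite -raddfB; exact: Im_le_modulus.
exists (a +i* b)%C => e e0; have e20 : 0 < e / 2 by rewrite divr_gt0.
have [[N Nu] [M Mu]] := (ua _ e20, ub _ e20).
exists (maxn N M) => n; rewrite geq_max => /andP[/Nu Re /Mu Im].
rewrite (le_lt_trans (modulus_Re_Im _))// [ltRHS]splitr !raddfB/=.
exact: ltrD.
Qed.

(** Pairs of rationals serve as one countable index type for both scalar fields. *)
Definition rat_scalar {R : realType} {k : scalar_kind} :
    rat * rat -> scalar_field R k :=
  match k with
  | RealScalars => fun q => ratr q.1
  | ComplexScalars => fun q => (ratr q.1 +i* ratr q.2)%C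
  end.

Lemma real_rat_approx (R : realType) (x e : R) : 0 < e ->
  exists q : rat, `|x - ratr q| < e.
Proof.
move=> e0; have [q] : exists q : rat, ratr q \in `]x, (x + e)[.
  by apply: rat_in_itvoo; rewrite ltrDl.
rewrite in_itv /= => /andP[xq qe]; exists q.
by rewrite distrC gtr0_norm ?subr_gt0// ltrBlDl.
Qed.

Lemma rat_scalar_dense (R : realType) (k : scalar_kind) (z : scalar_field R k)
    (e : R) :
  0 < e -> exists q, modulus (z - rat_scalar q) < e.
Proof.
case: k z => z e0.
  by have [q zq] := real_rat_approx z e0; exists (q, 0).
have e20 : 0 < e / 2 by rewrite divr_gt0.
have [q zq] := real_rat_approx (complex.Re z) e20.
have [r zr] := real_rat_approx (complex.Im z) e20.
exists (q, r); rewrite (le_lt_trans (modulus_Re_Im _))// [ltRHS]splitr !raddfB/=.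
exact: ltrD.
Qed.

Definition box (N : nat) : seq int := [seq i%:Z - N%:Z | i <- iota 0 (2 * N).+1].

Lemma mem_box N (n : int) : (n \in box N) = (`|n| <= N)%N.
Proof.
apply/mapP/idP => [ [j] | nN]; first by rewrite mem_iota => ? ->; lia.
by exists `|(n + N%:Z)%R|%N; [rewrite mem_iota; lia|lia].
Qed.

Lemma box_uniq N : uniq (box N).
Proof. by rewrite map_inj_uniq ?iota_uniq// => i j; lia. Qed.

Lemma finite_set_box (A : set int) : finite_set A ->
  exists N, forall n, A n -> n \in box N.
Proof.
move=> /finite_seqP[r ->]; exists (\max_(n <- r) `|n|)%N => n /= nr.
by rewrite mem_box; exact: leq_bigmax_seq.
Qed.

(** * Norm bounds for bilateral sequences *)

Section seq_norm_bound.
Context {R : realType} {k : scalar_kind}.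
Local Notation K := (scalar_field R k).

Definition lp_sum (p : R) (x : int -> K^o) : \bar R :=
  (\esum_(n in [set: int]) (modulus (x n) `^ p)%:E)%E.

(** For members of the space and [0 <= c] this means norm at most [c]. It is also meaningful for
    other sequences, where [sup] and [fine] in [seq_norm] may return default values; limits not yet
    known to be members need this. *)
Definition seq_norm_bound (s : seq_kind R) (c : R) (x : int -> K^o) : Prop :=
  match s with
  | SeqC0 => forall n, modulus (x n) <= c
  | SeqLp p _ => (lp_sum p x <= (c `^ p)%:E)%E
  end.

Lemma lp_sum_ge0 p (x : int -> K^o) : (0 <= lp_sum p x)%E.
Proof. by apply: esum_ge0 => n _; rewrite lee_fin powR_ge0. Qed.

Lemma ge1_gt0 (p : R) : 1 <= p -> 0 < p.
Proof. exact: lt_le_trans. Qed.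

Lemma ler_powR2 (p a b : R) : 0 < p -> 0 <= a -> 0 <= b ->
  (a `^ p <= b `^ p) = (a <= b).
Proof.
move=> p0 a0 b0; apply/idP/idP => [|ab].
  by apply: contraTT; rewrite -!ltNge; apply: gt0_ltr_powR; rewrite ?nnegrE.
by apply: ge0_ler_powR; rewrite ?nnegrE// ltW.
Qed.

Lemma lp_sum_shift p (x : int -> K^o) c :
  lp_sum p (fun n => x (n + c)) = lp_sum p x.
Proof.
rewrite /lp_sum [RHS](@reindex_esum _ _ _ [set: int] _ (fun n => n + c))//.
rewrite setTT_bijective; exists (fun n => n - c) => n; first exact: addrK.
exact: subrK.
Qed.

Lemma le_lp_sum p (x y : int -> K^o) : 0 < p ->
  (forall n, modulus (x n) <= modulus (y n)) -> (lp_sum p x <= lp_sum p y)%E.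
Proof.
by move=> p0 xy; apply: le_esum => n _; rewrite lee_fin ler_powR2 ?modulus_ge0.
Qed.

Lemma seq_normP s c (x : int -> K^o) : seq_mem s x -> 0 <= c ->
  seq_norm s x <= c <-> seq_norm_bound s c x.
Proof.
case: s => [|p p1] xs c0 /=.
  split=> [xc n|xc]; last first.
    by apply: ge_sup; [exists (modulus (x 0)), 0|move=> _ [n _ <-]].
  apply: le_trans xc; apply: ub_le_sup; last by exists n.
  have [N Nx] := xs 1 ltr01.
  (* Entries with index at least [N] in absolute value have modulus below 1; the sum dominates the
     finitely many others. *)
  exists (1 + \sum_(i < N) (modulus (x i%:Z) + modulus (x (- i%:Z)))).
  move=> _ [m _ <-]; have [/Nx /ltW mx|mN] := leqP N `|m|.
    by rewrite (le_trans mx)// lerDl sumr_ge0// => i _; rewrite addr_ge0// modulus_ge0.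
  rewrite (bigD1 (Ordinal mN))//= addrCA -[leLHS]addr0 lerD//; last first.
    by rewrite addr_ge0// sumr_ge0// => i _; rewrite addr_ge0// modulus_ge0.
  have /orP[/eqP->|/eqP->] : (m == `|m|%N%:Z) || (m == - `|m|%N%:Z) by lia.
    by rewrite absz_nat lerDl modulus_ge0.
  by rewrite abszN absz_nat lerDr modulus_ge0.
have p0 := ge1_gt0 p1; have E0 := lp_sum_ge0 p x.
have Efin : lp_sum p x \is a fin_num by rewrite ge0_fin_numE.
rewrite -/(lp_sum p x) -(ler_powR2 p0) ?powR_ge0//.
rewrite -powRrM mulVf ?gt_eqF// powRr1 ?fine_ge0//.
by rewrite -lee_fin fineK.
Qed.

Lemma seq_norm_ge0 s (x : int -> K^o) : seq_mem s x -> 0 <= seq_norm s x.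
Proof.
case: s => [|p p1] xs /=; last exact: powR_ge0.
have [h|h] := pselect (has_sup [set modulus (x n) | n in [set: int]]).
  by apply: (le_trans (modulus_ge0 (x 0))); apply: ub_le_sup; [case: h|exists 0].
by rewrite sup_out.
Qed.

Lemma modulus_le_seq_norm s (x : int -> K^o) n : seq_mem s x ->
  modulus (x n) <= seq_norm s x.
Proof.
move=> xs; have x0 := seq_norm_ge0 xs.
have := (seq_normP xs x0).1 (lexx _); case: s xs x0 => [|p p1] xs x0 //= xp.
rewrite -(ler_powR2 (ge1_gt0 p1)) ?modulus_ge0//.
rewrite -lee_fin (le_trans _ xp)//; apply: esum_ge; exists [set n] => //.
by rewrite fsbig_set1.
Qed.

Lemma seq_mem_shift s (x y : int -> K^o) c : seq_mem s x ->
  (forall n, modulus (y n) <= modulus (x (n + c))) -> seq_mem s y.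
Proof.
case: s => [|p p1] /= xs yx.
  move=> e /xs[N Nx]; exists (N + `|c|)%N => n Nn.
  by apply: le_lt_trans (yx n) (Nx _ _); lia.
apply: le_lt_trans xs; rewrite -/(lp_sum p y) -/(lp_sum p x) -(lp_sum_shift p x c).
exact: le_lp_sum (ge1_gt0 p1) yx.
Qed.

(** The norms are invariant under translation of the index and monotone in the moduli of the
    entries. This one comparison serves the shifts and, with [c = 0], the truncations. *)
Lemma seq_norm_shift s (x y : int -> K^o) c : seq_mem s x ->
  (forall n, modulus (y n) <= modulus (x (n + c))) ->
  seq_norm s y <= seq_norm s x.
Proof.
move=> xs yx; have x0 := seq_norm_ge0 xs.
apply/seq_normP => //; first exact: seq_mem_shift yx.
have := (seq_normP xs x0).1 (lexx _); case: s xs x0 => [|p p1] xs x0 /= xb.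
  by move=> n; exact: le_trans (yx n) (xb _).
apply: le_trans xb; rewrite -(lp_sum_shift p x c).
exact: le_lp_sum (ge1_gt0 p1) yx.
Qed.

Lemma seq_norm_bound_delta s n :
  seq_norm_bound s 1 (fun m => (m == n)%:R : K^o).
Proof.
case: s => [|p p1] /=.
  by move=> m; case: eqP; rewrite ?modulus1 ?modulus0.
rewrite /lp_sum (esumID [set n]); last by move=> *; rewrite lee_fin powR_ge0.
rewrite setTI esum_set1 ?lee_fin ?powR_ge0// setTI [X in (_ + X)%E]esum1 ?adde0.
  by rewrite eqxx modulus1.
move=> m /= /eqP/negPf ->.
by rewrite modulus0 powR0// gt_eqF// ge1_gt0.
Qed.

(** The [p]-sum is a supremum of finite sums, and each finite index set lies in some box. *)
Lemma seq_norm_bound_trunc s c (x : int -> K^o) :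
  (forall N, seq_norm_bound s c (fun n => if (`|n| <= N)%N then x n else 0)) ->
  seq_norm_bound s c x.
Proof.
case: s => [|p p1] /= xc.
  by move=> n; have := xc `|n|%N n; rewrite leqnn.
apply: ge_ereal_sup => _ [A [fA _] <-]; have [N AN] := finite_set_box fA.
apply: le_trans (xc N); apply: esum_ge; exists A => //.
by apply: lee_fsum => // n /AN; rewrite mem_box => ->.
Qed.

End seq_norm_bound.

Section seq_space_theory.
Context {R : realType} {k : scalar_kind} {s : seq_kind R}.
Local Notation K := (scalar_field R k).
Local Notation V := (seq_space k s).
Implicit Types (x y : V) (n : int).

Definition nrm x : R := seq_norm s x.

Lemma seq_space_mem x : seq_mem s x.
Proof. exact/set_mem/seq_valP. Qed.

Lemma seq_ext x y : (forall n, x n = y n) -> x = y.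
Proof. by move=> xy; apply: val_inj; apply/funext. Qed.

Lemma seq_val_add x y n : (x + y) n = x n + y n. Proof. by []. Qed.
Lemma seq_val_sub x y n : (x - y) n = x n - y n. Proof. by []. Qed.
Lemma seq_val_scale (a : K) x n : (a *: x) n = a * x n. Proof. by []. Qed.
Lemma seq_val_sum (I : Type) (r : seq I) (f : I -> V) n :
  (\sum_(i <- r) f i) n = \sum_(i <- r) f i n.
Proof. by elim: r => [|i r IHr]; rewrite ?big_nil ?big_cons// seq_val_add IHr. Qed.

Lemma nrm_ge0 x : 0 <= nrm x.
Proof. exact/seq_norm_ge0/seq_space_mem. Qed.

Lemma nrmD x y : nrm (x + y) <= nrm x + nrm y.
Proof. exact: (seq_normD (seq_space_mem x) (seq_space_mem y)). Qed.

Lemma nrmZ (a : K) x : nrm (a *: x) = modulus a * nrm x.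
Proof. exact: (seq_normZ a (seq_space_mem x)). Qed.

Lemma nrmN x : nrm (- x) = nrm x.
Proof. by rewrite -scaleN1r nrmZ modulusN modulus1 mul1r. Qed.

Lemma nrm0 : nrm 0 = 0.
Proof. by rewrite -(scale0r (0 : V)) nrmZ modulus0 mul0r. Qed.

Lemma nrm_eq0 x : nrm x = 0 -> x = 0.
Proof.
by move=> x0; apply: val_inj; apply: seq_norm_eq0 x0; exact: seq_space_mem.
Qed.

Lemma nrmB x y : nrm (x - y) = nrm (y - x).
Proof. by rewrite -nrmN opprB. Qed.

Lemma nrm_sum (I : Type) (r : seq I) (f : I -> V) :
  nrm (\sum_(i <- r) f i) <= \sum_(i <- r) nrm (f i).
Proof.
elim: r => [|i r IHr]; rewrite ?big_nil ?nrm0// !big_cons.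
by rewrite (le_trans (nrmD _ _))// lerD.
Qed.

Lemma modulus_le_nrm x n : modulus (x n) <= nrm x.
Proof. exact/modulus_le_seq_norm/seq_space_mem. Qed.

Lemma normE x : `|x| = of_real (nrm x) :> K.
Proof. by []. Qed.

Lemma seq_nbhsP x (A : set V) :
  nbhs x A <-> exists2 e : R, 0 < e & [set y | nrm (x - y) < e] `<=` A.
Proof.
have ltr_of_real (a b : R) : (of_real a < of_real b :> K) = (a < b).
  rewrite !lt_def ler_of_real; congr (~~ _ && _).
  by apply/eqP/eqP => [/of_real_inj|->].
split=> [/nbhs_ballP[e /= e0 eA]|[e e0 eA]]; last first.
  apply/nbhs_ballP; exists (of_real e); first by rewrite /= -of_real0 ltr_of_real.
  move=> y; rewrite -ball_normE /= => xy; apply: eA => /=.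
  by move: xy; rewrite -ltr_of_real -normE.
(* A positive scalar is real even in the complex case, so a radius in [K] comes from one in [R]. *)
have e0' : of_real (modulus (e : K)) = e by rewrite of_real_modulus gtr0_norm.
exists (modulus (e : K)).
  by rewrite -ltr_of_real of_real0 e0'.
move=> y /= xy; apply: eA; rewrite -ball_normE /=.
by rewrite normE -e0' ltr_of_real.
Qed.

Lemma delta_subproof n :
  (fun m => (m == n)%:R : K^o) \in seq_pred (k := k) s.
Proof.
rewrite inE; case: s => [|p p1] /=.
  move=> e e0; exists `|n|.+1 => m nm.
  have /negPf -> : m != n by apply: contraTneq nm => ->; rewrite ltnn.
  by rewrite modulus0.
rewrite (esumID [set n]); last by move=> *; rewrite lee_fin powR_ge0.
rewrite setTI esum_set1 ?lee_fin ?powR_ge0// setTI [X in (_ + X)%E]esum1 ?adde0 ?ltry//.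
move=> m /= /eqP/negPf ->.
by rewrite modulus0 powR0// gt_eqF// ge1_gt0.
Qed.

Definition delta n : V := SeqSpace (delta_subproof n).

Lemma deltaE n m : delta n m = (m == n)%:R.
Proof. by []. Qed.

Lemma nrm_delta n : nrm (delta n) <= 1.
Proof.
apply/seq_normP => //; first exact: seq_space_mem.
exact: seq_norm_bound_delta.
Qed.

(** The argument is an arbitrary function, so that a pointwise limit can be truncated before it is
    known to lie in the space. *)
Definition trunc (N : nat) (f : int -> K^o) : V :=
  \sum_(n <- box N) (f n : K) *: delta n.

Lemma truncE N f n : trunc N f n = if (`|n| <= N)%N then f n else 0.
Proof.
rewrite /trunc seq_val_sum; under eq_bigr do rewrite seq_val_scale deltaE.
have [nN|nN] := ifPn.
  rewrite (bigD1_seq n) ?mem_box ?box_uniq//= big1 => [|m mn].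
    by rewrite addr0 eqxx mulr1.
  by rewrite eq_sym (negPf mn) mulr0.
rewrite big_seq big1// => m; rewrite mem_box => mN.
have /negPf -> : n != m by apply: contraNneq nN => ->.
by rewrite mulr0.
Qed.

Lemma nrm_trunc_le_sum N f : nrm (trunc N f) <= \sum_(n <- box N) modulus (f n).
Proof.
apply: le_trans (nrm_sum _ _) _; apply: ler_sum => n _.
by rewrite nrmZ -[leRHS]mulr1 ler_wpM2l ?modulus_ge0 ?nrm_delta.
Qed.

Lemma nrm_le (x y : V) : (forall n, modulus (y n) <= modulus (x n)) ->
  nrm y <= nrm x.
Proof.
move=> yx; apply: (seq_norm_shift (c := 0)); first exact: seq_space_mem.
by move=> n; rewrite addr0.
Qed.

Lemma seq_norm_bound_nrm c x : 0 <= c -> seq_norm_bound s c x -> nrm x <= c.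
Proof. by move=> c0; apply: (seq_normP _ _).2 => //; exact: seq_space_mem. Qed.

Lemma trunc_bound c (f : int -> K^o) : 0 <= c ->
  (forall N, nrm (trunc N f) <= c) -> seq_norm_bound s c f.
Proof.
move=> c0 fc; apply: seq_norm_bound_trunc => N.
have := (seq_normP (seq_space_mem _) c0).1 (fc N).
by congr seq_norm_bound; apply/funext => n; rewrite truncE.
Qed.

End seq_space_theory.

(** * Completeness, separability and infinite dimension of the sequence spaces *)

Section seq_space_frechet.
Context {R : realType} {k : scalar_kind} {s : seq_kind R}.
Local Notation K := (scalar_field R k).
Local Notation V := (seq_space k s).

(** In the [p]-summable case some finite partial sum comes within [e ^ p] of the total; beyond a box
    containing its index set only the remainder is left. *)
Lemma seq_norm_bound_tail s' (x : int -> K^o) (e : R) : seq_mem s' x -> 0 < e ->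
  exists N, forall M, (N <= M)%N ->
    seq_norm_bound s' e (fun n => if (`|n| <= M)%N then 0 else x n).
Proof.
case: s' => [|p p1] /= xs e0.
  have [N Nx] := xs e e0; exists N => M NM n; case: leqP => nM.
    by rewrite modulus0 ltW.
  by apply/ltW/Nx; lia.
have p0 := ge1_gt0 p1; have ep0 : 0 < e `^ p by rewrite powR_gt0.
have Efin : lp_sum p x \is a fin_num by rewrite ge0_fin_numE ?lp_sum_ge0.
have [_ [A [fA _] <-]] : exists2 y, [set \sum_(n \in A)
      (modulus (x n) `^ p)%:E | A in fsets [set: int]]%E y
    & (lp_sum p x - (e `^ p)%:E < y)%E.
  by apply: ereal_sup_gt; rewrite lteBlDr// lteDl// lte_fin.
rewrite lteBlDr// {1}/lp_sum (esumID A); last by move=> *; rewrite lee_fin powR_ge0.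
rewrite setTI esum_fset//; last by move=> *; rewrite lee_fin powR_ge0.
rewrite fsumEFin// lteD2lE// setTI => Ae.
have [N AN] := finite_set_box fA; exists N => M NM.
apply: le_trans (ltW Ae); rewrite [leRHS]esum_mkcond; apply: le_esum => n _.
case: ifPn => nM.
  by rewrite modulus0 powR0 ?gt_eqF//; case: ifP; rewrite ?lee_fin ?powR_ge0.
rewrite ifT// inE => /AN; rewrite mem_box => nN.
by rewrite (leq_trans nN NM) in nM.
Qed.

Lemma trunc_approx (x : V) (e : R) : 0 < e ->
  exists N, forall M, (N <= M)%N -> nrm (x - trunc M x) <= e.
Proof.
move=> e0; have [N xN] := seq_norm_bound_tail (seq_space_mem x) e0.
exists N => M /xN xM; apply: seq_norm_bound_nrm; first exact: ltW.
move: xM; congr seq_norm_bound; apply/funext => n.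
by rewrite seq_val_sub truncE; case: ifP; rewrite ?subrr ?subr0.
Qed.

(** In the [p]-summable case a single [y] at bound 1 suffices, as [x] is [y] minus the member
    [y - x]; for null sequences the tail of [x] is compared with that of [y] at [e/2]. *)
Lemma seq_mem_limit (x : int -> K^o) :
  (forall e : R, 0 < e -> exists y : V, seq_norm_bound s e (fun n => y n - x n)) ->
  seq_mem s x.
Proof.
move=> xy; have [y] := xy 1 ltr01; have := seq_space_mem y.
case: s xy y => [|p p1] /= xy y ys xs1.
  move=> e e0; have e20 : 0 < e / 2 by rewrite divr_gt0.
  have [z zx] := xy _ e20; have [N zN] := seq_space_mem z _ e20.
  exists N => n /zN zn; rewrite -(subKr (z n) (x n)) (le_lt_trans (modulusD _ _))//.
  by rewrite modulusN [ltRHS]splitr ltr_leD.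
have xyp : (y : int -> K^o) - x \in seq_pred (k := k) (SeqLp p1).
  by rewrite inE /=; apply: le_lt_trans xs1 _; exact: ltry.
have [_ sc] := seq_pred_submod (k := k) (SeqLp p1).
have := sc (-1) _ _ xyp (seq_valP y).
by rewrite scaleN1r opprB subrK inE.
Qed.

Lemma truncD N (f g : int -> K^o) :
  trunc N (fun n => f n + g n) = trunc N f + trunc N g :> V.
Proof.
by apply: seq_ext => n; rewrite seq_val_add !truncE; case: ifP; rewrite ?addr0.
Qed.

Lemma nrm_trunc_le N (f : int -> K^o) (x : V) :
  (forall n, modulus (f n) <= modulus (x n)) ->
  nrm (trunc N f : V) <= nrm x.
Proof.
move=> fx; apply: nrm_le => n; rewrite truncE; case: ifP => // _.
by rewrite modulus0 modulus_ge0.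
Qed.

(** The limit is built coordinatewise. On each box the distance to it is at most the Cauchy bound
    plus an arbitrarily small finite sum, and bounds on all truncations pass to the whole
    sequence. *)
Lemma seq_space_complete (u : nat -> V) :
  (forall e : R, 0 < e -> exists N, forall m n, (N <= m)%N -> (N <= n)%N ->
    nrm (u m - u n) < e) ->
  exists l : V, u @ \oo --> l.
Proof.
move=> uc.
have /choice[x ux] : forall n, exists y : K^o, forall e : R, 0 < e ->
    exists N, forall m, (N <= m)%N -> modulus (u m n - y) < e.
  move=> n; apply: (@scalar_cauchy_limit R k (fun m => u m n)) => e /uc[N uN].
  exists N => m l Nm Nl; apply: le_lt_trans (uN m l Nm Nl).
  exact: (modulus_le_nrm (u m - u l) n).
have sum_ux (r : seq int) (e : R) : 0 < e -> exists N, forall m, (N <= m)%N ->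
    \sum_(n <- r) modulus (u m n - x n) < e.
  elim: r e => [|n r IHr] e e0; first by exists 0%N => m _; rewrite big_nil.
  have e20 : 0 < e / 2 by rewrite divr_gt0.
  have [[N nN] [M rM]] := (ux n _ e20, IHr _ e20).
  exists (maxn N M) => m; rewrite geq_max => /andP[/nN ? /rM ?].
  by rewrite big_cons [ltRHS]splitr ltrD.
have u_bound (e : R) : 0 < e -> exists N, forall m, (N <= m)%N ->
    seq_norm_bound s e (fun n => u m n - x n).
  move=> e0; have [N uN] := uc e e0; exists N => m Nm.
  apply: trunc_bound => [|M]; first exact: ltW.
  apply/ler_addgt0Pr => e' e'0; have [L uL] := sum_ux (box M) e' e'0.
  (* The index [l] is past [N], for the Cauchy bound, and past [L], for coordinatewise closeness on
     the box. *)
  have [NL LL] := (leq_maxl N L, leq_maxr N L); set l := maxn N L in NL LL.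
  have -> : trunc M (fun n => u m n - x n) =
      trunc M (u m - u l) + trunc M (fun n => u l n - x n) :> V.
    by rewrite -truncD; congr trunc; apply/funext => n; rewrite seq_val_sub addrA subrK.
  rewrite (le_trans (nrmD _ _))// lerD//.
    by apply/ltW/(le_lt_trans _ (uN m l Nm NL)); exact: nrm_trunc_le.
  exact/ltW/(le_lt_trans (nrm_trunc_le_sum _ _))/uL.
have xs : x \in seq_pred (k := k) s.
  rewrite inE; apply: seq_mem_limit => e /u_bound[N uN].
  by exists (u N); exact: uN.
exists (SeqSpace xs) => A /seq_nbhsP[e e0 eA].
have [N uN] := u_bound (e / 2) (divr_gt0 e0 (ltr0Sn _ 1)).
exists N => // m /= /uN umx; apply: eA => /=.
rewrite nrmB (@le_lt_trans _ _ (e / 2))//; last first.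
  by rewrite ltr_pdivrMr// ltr_pMr// ltr1n.
by apply: seq_norm_bound_nrm; rewrite // divr_ge0// ltW.
Qed.

Lemma seq_space_frechet : frechet_space V.
Proof.
exists (fun x y => nrm (x - y)); split.
- move=> x y; split=> [/nrm_eq0/eqP|->]; last by rewrite subrr nrm0.
  by rewrite subr_eq0 => /eqP.
- exact: nrmB.
- by move=> x y z; rewrite -{1}(subrK y x) -addrA nrmD.
- by move=> x y z; rewrite opprD addrACA subrr addr0.
- by split; [exact: seq_nbhsP|exact: seq_space_complete].
Qed.

Lemma seq_space_separable : separable_space V.
Proof.
pose f (t : seq (int * (rat * rat))) : V :=
  \sum_(a <- t) (rat_scalar a.2 : K) *: delta a.1.
exists (range f); split.
  by apply: (sub_countable (card_image_le _ _)); exact: countableP.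
move=> O [x Ox] oO; have /seq_nbhsP[r r0 rO] := open_nbhs_nbhs (conj oO Ox).
have r20 : 0 < r / 2 by rewrite divr_gt0.
have [N /(_ N (leqnn N)) xN] := trunc_approx x r20.
(* Each coordinate of the box gets an equal share of [r/2]; the successor in the denominator makes
   the total strictly smaller and the division safe. *)
have e0 : 0 < r / 2 / (size (box N)).+1%:R by rewrite divr_gt0.
have [q qx] := choice (fun n => rat_scalar_dense (x n : K) e0).
pose y : V := trunc N (fun n => rat_scalar (q n)).
have yE : f [seq (n, q n) | n <- box N] = y by rewrite /f big_map.
exists y; split; last by exists [seq (n, q n) | n <- box N].
apply: rO; rewrite /mkset -(subrK (trunc N x) x) -addrA.
apply: (le_lt_trans (nrmD _ _)); rewrite [ltRHS]splitr; apply: (ler_ltD xN).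
have -> : trunc N x - y = trunc N (fun n => x n - rat_scalar (q n)).
  apply: seq_ext => n; rewrite seq_val_sub !truncE.
  by case: ifP => //; rewrite subr0.
apply: le_lt_trans (nrm_trunc_le_sum _ _) _.
apply: (@le_lt_trans _ _ (\sum_(n <- box N) r / 2 / (size (box N)).+1%:R)).
  by apply: ler_sum => n _; exact/ltW/qx.
rewrite big_const_seq count_predT iter_addr_0 -[ltLHS]mulr_natr mulrAC.
by rewrite ltr_pdivrMr// ltr_pM2l// ltr_nat.
Qed.

(** If [n] vectors spanned, the coefficient matrix of [n + 1] unit vectors would have a nonzero left
    kernel vector, hence a nontrivial linear relation among unit vectors. *)
Lemma seq_space_infinite_dimensional : infinite_dimensional V.
Proof.
move=> [n [e espan]].
have [c cP] := choice (fun j : 'I_n.+1 => espan (delta j%:Z)).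
pose C : 'M[K]_(n.+1, n) := \matrix_(j, i) c j i.
have : kermx C != 0.
  rewrite -mxrank_eq0 mxrank_ker subn_eq0 -ltnNge.
  exact: leq_ltn_trans (rank_leq_col C) (ltnSn n).
move=> /rowV0Pn[v /sub_kermxP vC /eqP]; apply; apply/rowP => j; rewrite mxE.
have v0 : \sum_(i < n.+1) v 0 i *: (delta i%:Z : V) = 0.
  under eq_bigr => i _ do rewrite cP scaler_sumr.
  rewrite exchange_big big1//= => i _.
  under eq_bigr => l _ do rewrite scalerA.
  rewrite -scaler_suml.
  have /matrixP/(_ 0 i) := vC; rewrite !mxE.
  under eq_bigr => l _ do rewrite mxE.
  by move=> ->; rewrite scale0r.
have := congr1 (fun x : V => x j%:Z) v0; rewrite seq_val_sum.
under eq_bigr => l _ do rewrite seq_val_scale deltaE.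
rewrite (bigD1 j)//= eqxx mulr1 big1 ?addr0// => l lj.
have /negPf -> : (j%:Z != l%:Z) by rewrite eqz_nat eq_sym.
by rewrite mulr0.
Qed.

End seq_space_frechet.

(** * Weighted shifts *)

Section weighted_shift.
Context {R : realType} {k : scalar_kind} {s : seq_kind R}.
Local Notation K := (scalar_field R k).
Local Notation V := (seq_space k s).
Variable g : int -> nat.
Hypothesis g_lip : forall m n : int, (g (m + n)%R <= g m + `|n|)%N.
Hypothesis g0 : g 0 = 0%N.

Let wratio (c n : int) : R := 2 ^+ g (n + c) / 2 ^+ g n.

Let wratio_ge0 c n : 0 <= wratio c n.
Proof. by rewrite divr_ge0// exprn_ge0. Qed.

(** The Lipschitz property of [g] enters here; it makes the shifts by all integers, negative ones
    included, bounded. *)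
Let wratio_le c n : wratio c n <= 2 ^+ `|c|%N.
Proof.
rewrite ler_pdivrMr ?exprn_gt0// -exprD addnC.
by rewrite ler_weXn2l ?ler1n.
Qed.

Let shift_fun (c : int) (x : V) (n : int) : K^o := of_real (wratio c n) * x (n + c).

Let modulus_shift_fun c x n :
  modulus (shift_fun c x n) = wratio c n * modulus (x (n + c)).
Proof. by rewrite modulusM modulus_of_real. Qed.

Let shift_fun_le c x n :
  modulus (shift_fun c x n) <= modulus ((of_real (2 ^+ `|c|%N) *: x : V) (n + c)).
Proof.
rewrite modulus_shift_fun seq_val_scale modulusM modulus_of_real ?exprn_ge0//.
by rewrite ler_wpM2r ?modulus_ge0.
Qed.

Let shift_subproof c x : shift_fun c x \in seq_pred (k := k) s.
Proof. by rewrite inE; exact: seq_mem_shift (seq_space_mem _) (shift_fun_le c x). Qed.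

(* the shift by [c] conjugated by the diagonal operator of weights [2 ^ g] *)
Definition diag_shift c (x : V) : V := SeqSpace (shift_subproof c x).

Lemma diag_shiftE c x n :
  diag_shift c x n = of_real (2 ^+ g (n + c) / 2 ^+ g n) * x (n + c).
Proof. by []. Qed.

Lemma diag_shift_linear c : linear (diag_shift c).
Proof.
move=> a x y; apply: seq_ext => n.
rewrite seq_val_add seq_val_scale !diag_shiftE seq_val_add seq_val_scale.
by rewrite mulrDr mulrCA.
Qed.

HB.instance Definition _ c := GRing.isLinear.Build K V V _ (diag_shift c)
  (diag_shift_linear c).

Lemma diag_shift_bounded c x : nrm (diag_shift c x) <= 2 ^+ `|c|%N * nrm x.
Proof.
rewrite -[X in X * _](@modulus_of_real R k) ?exprn_ge0// -nrmZ.
exact: seq_norm_shift (seq_space_mem _) (shift_fun_le c x).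
Qed.

Lemma diag_shift_continuous c : continuous (diag_shift c).
Proof.
move=> x A /seq_nbhsP[e e0 eA]; apply/seq_nbhsP.
exists (e / 2 ^+ `|c|%N); first by rewrite divr_gt0// exprn_gt0.
move=> y; rewrite /mkset ltr_pdivlMr ?exprn_gt0// mulrC => xy; apply: eA.
by rewrite /mkset -raddfB; apply: le_lt_trans (diag_shift_bounded c _) xy.
Qed.

(** The quotients of powers of 2 telescope. This group law gives both the iterates and the
    inverse. *)
Lemma diag_shiftD c c' x : diag_shift c (diag_shift c' x) = diag_shift (c + c') x.
Proof.
apply: seq_ext => n; rewrite !diag_shiftE mulrA -of_realM addrA; congr (of_real _ * _).
by rewrite mulrC mulrA divfK// expf_neq0.
Qed.

Lemma diag_shift0 x : diag_shift 0 x = x.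
Proof.
by apply: seq_ext => n; rewrite diag_shiftE addr0 divff ?expf_neq0// of_real1 mul1r.
Qed.

Lemma iter_diag_shift c n x : iter n (diag_shift c) x = diag_shift (c * n%:Z) x.
Proof.
elim: n => [|n IHn]; first by rewrite mulr0 diag_shift0.
by rewrite iterS IHn diag_shiftD -[in RHS]addn1 PoszD mulrDr mulr1 addrC.
Qed.

Lemma diag_shift_invertible : invertible (diag_shift 1).
Proof.
exists (diag_shift (-1)); split; last exact: diag_shift_continuous.
  by move=> x; rewrite diag_shiftD addNr diag_shift0.
by move=> x; rewrite diag_shiftD subrr diag_shift0.
Qed.

Lemma diag_shift_weighted : bilateral_weighted_backward_shift (diag_shift 1).
Proof.
(* Entry [n] of the image carries the weight with index [n + 1], hence the offset: the weight at [n]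
   is [2 ^ (g n - g (n - 1))]. *)
exists (fun n => wratio 1 (n - 1)); split.
- by move=> n; rewrite divr_gt0// exprn_gt0.
- by exists (2 ^+ `|1|%N) => n; exact: wratio_le.
- by move=> x n; rewrite addrK.
Qed.

(** Only entries with [|n + c| <= N] survive. There the Lipschitz property gives
    [g (n + c) <= g 0 + N = N] and [g n >= g (- c) - N >= N + L], so the weight is at most
    [2 ^- L]. *)
Lemma nrm_diag_shift_trunc N L c (x : V) : (2 * N + L <= g (- c))%N ->
  nrm (diag_shift c (trunc N x)) <= 2 ^- L * nrm x.
Proof.
move=> NLg; have L0 : 0 <= 2 ^- L :> R by rewrite invr_ge0 exprn_ge0.
rewrite -[X in X * _](@modulus_of_real R k)// -nrmZ.
apply: (seq_norm_shift (c := c)); first exact: seq_space_mem.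
move=> n; rewrite modulus_shift_fun truncE seq_val_scale modulusM modulus_of_real//.
case: ifPn => [nN|_]; last by rewrite modulus0 mulr0 mulr_ge0// modulus_ge0.
rewrite ler_wpM2r ?modulus_ge0// /wratio ler_pdivrMr ?exprn_gt0//.
rewrite ler_pdivlMl ?exprn_gt0// -exprD ler_weXn2l ?ler1n//.
have h1 := g_lip 0 (n + c); have h2 := g_lip n (- (n + c)).
rewrite add0r g0 in h1; have e2 : n + - (n + c) = - c by lia.
rewrite e2 in h2; lia.
Qed.

(** As in Kitai's criterion: for truncations of [u] and [v], the shifts by [n] and [- n] are small
    when [g] is large at [- n] and [n], so the first truncation plus the backward image of the
    second starts near [u] and arrives near [v]. *)
Lemma diag_shift_hits (U U' : set V) : open U -> open U' -> U !=set0 -> U' !=set0 ->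
  exists l, forall n : nat, (l <= g n%:Z)%N -> (l <= g (- n%:Z))%N ->
    hitting_times (diag_shift 1) U U' n.
Proof.
move=> oU oU' [u Uu] [v U'v].
have /seq_nbhsP[r r0 rU] := open_nbhs_nbhs (conj oU Uu).
have /seq_nbhsP[r' r'0 rU'] := open_nbhs_nbhs (conj oU' U'v).
(* One [e] pays for the truncation error, the other for the small shifted vector. *)
pose e := Num.min r r' / 2.
have e0 : 0 < e by rewrite divr_gt0// lt_min r0.
have e2r : e + e <= r by rewrite -splitr ge_min lexx.
have e2r' : e + e <= r' by rewrite -splitr ge_min lexx orbT.
have [N1 uN] := trunc_approx u e0; have [N2 vN] := trunc_approx v e0.
set N := maxn N1 N2; have {}uN := uN N (leq_maxl _ _).
have {}vN := vN N (leq_maxr _ _).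
pose b := nrm u + nrm v.
have b0 : 0 <= b by rewrite addr_ge0 ?nrm_ge0.
have [L bL] : exists L : nat, b / e < 2 ^+ L.
  exists (Num.truncn (b / e)).+1; apply: lt_trans (truncnS_gt _) _.
  by rewrite -natrX ltr_nat ltn_expl.
have small c (x : V) : nrm x <= b -> (2 * N + L <= g (- c))%N ->
    nrm (diag_shift c (trunc N x)) < e.
  move=> xb cg; apply: le_lt_trans (nrm_diag_shift_trunc x cg) _.
  rewrite mulrC ltr_pdivrMr ?exprn_gt0//; apply: le_lt_trans xb _.
  by rewrite mulrC -ltr_pdivrMr.
exists (2 * N + L)%N => n ng ng'; apply/hitting_timesP.
exists (trunc N u + diag_shift (- n%:Z) (trunc N v)).
  apply: rU; rewrite /mkset opprD addrA; apply: le_lt_trans (nrmD _ _) _.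
  rewrite nrmN; apply: (lt_le_trans _ e2r); apply: (ler_ltD uN); apply: small.
    by rewrite lerDr nrm_ge0.
  by rewrite opprK.
apply: rU'; rewrite /mkset iter_diag_shift mul1r raddfD /= diag_shiftD subrr diag_shift0.
rewrite opprD addrCA addrC; apply: le_lt_trans (nrmD _ _) _.
rewrite nrmN; apply: (lt_le_trans _ e2r'); apply: (ler_ltD vN).
by apply: (small _ _ _ ng'); rewrite lerDl nrm_ge0.
Qed.

Lemma open_seq_ball (x : V) (r : R) : open [set y : V | nrm (x - y) < r].
Proof.
rewrite openE => y; rewrite /mkset => xy; apply/seq_nbhsP.
exists (r - nrm (x - y)); first by rewrite subr_gt0.
move=> z; rewrite /mkset => yz.
have {}yz : nrm (x - y) + nrm (y - z) < r by rewrite -ltrBrDl.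
apply: (le_lt_trans _ yz).
by have := nrmD (x - y) (y - z); rewrite addrA subrK.
Qed.

(** If [g n = 0], then entry 0 of the [n]-th iterate of [x] is exactly entry [n] of [x]. It would be
    within 1/2 of 0, as [x] is near 0, and within 1/2 of 1, as the iterate is near [delta 0]. *)
Lemma diag_shift_hitting_support :
  exists U U' : set V, [/\ open U, open U', U !=set0, U' !=set0 &
    hitting_times (diag_shift 1) U U' `<=` [set n | (0 < g n%:Z)%N]].
Proof.
exists [set y : V | nrm (0 - y) < 2^-1], [set y : V | nrm (delta 0 - y) < 2^-1].
have h0 : 0 < 2^-1 :> R by rewrite invr_gt0.
split; [exact: open_seq_ball|exact: open_seq_ball|exists 0|exists (delta 0)|].
- by rewrite /mkset subrr nrm0.
- by rewrite /mkset subrr nrm0.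
move=> n /hitting_timesP[x]; rewrite /mkset sub0r nrmN => x_small.
rewrite iter_diag_shift mul1r => y_near; rewrite lt0n; apply/eqP => gn0.
have := le_lt_trans (modulus_le_nrm _ 0) y_near.
rewrite seq_val_sub diag_shiftE add0r gn0 g0 divff// of_real1 mul1r deltaE eqxx.
move=> near1; have xn := le_lt_trans (modulus_le_nrm x n%:Z) x_small.
have := modulusD (1 - x n%:Z : K) (x n%:Z); rewrite subrK modulus1 => le1.
have := le_lt_trans le1 (ltrD near1 xn).
by rewrite -[2^-1]mul1r -splitr ltxx.
Qed.

End weighted_shift.

(** * Common hitting times from a hypercyclic direct sum *)

Section isolated_points.
Context {R : realType} {k : scalar_kind} {s : seq_kind R}.
Local Notation V := (seq_space k s).

Lemma open_setD1 (O : set V) y : open O -> O !=set0 ->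
  open (O `&` [set z | z <> y]) /\ O `&` [set z | z <> y] !=set0.
Proof.
move=> oO [z Oz]; split.
  rewrite openE => t [Ot ty]; apply/seq_nbhsP.
  have /seq_nbhsP[r r0 rO] := open_nbhs_nbhs (conj oO Ot).
  have ty0 : 0 < nrm (t - y).
    rewrite lt_def nrm_ge0 andbT; apply/eqP => /nrm_eq0/eqP.
    by rewrite subr_eq0 => /eqP.
  exists (Num.min r (nrm (t - y))); first by rewrite lt_min r0.
  move=> u; rewrite /mkset lt_min => /andP[ur uy]; split; first exact: rO.
  by move=> uy'; rewrite uy' ltxx in uy.
have [zy|] := pselect (z = y); last by exists z.
have /seq_nbhsP[r r0 rO] := open_nbhs_nbhs (conj oO Oz).
have r20 : 0 < r / 2 by rewrite divr_gt0.
(* If the chosen point is the one removed, a small nonzero perturbation of it stays in [O]. *)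
pose h : V := of_real (r / 2) *: delta 0; exists (z + h); split.
  apply: rO; rewrite /mkset opprD addrA subrr sub0r nrmN nrmZ.
  rewrite modulus_of_real ?(ltW r20)//.
  apply: (@le_lt_trans _ _ (r / 2)); last by rewrite ltr_pdivrMr// ltr_pMr// ltr1n.
  by rewrite -[leRHS]mulr1 ler_wpM2l ?(ltW r20)// nrm_delta.
rewrite /mkset -zy => /(congr1 (fun t : V => t 0)).
rewrite seq_val_add seq_val_scale deltaE eqxx mulr1 => /eqP.
rewrite -subr_eq0 addrC addKr -(@of_real0 R k) => /eqP/of_real_inj re.
by rewrite re ltxx in r20.
Qed.

Lemma open_avoid (O : set V) (u : nat -> V) n : open O -> O !=set0 ->
  exists Q, [/\ open Q, Q !=set0, Q `<=` O & forall i, (i <= n)%N -> ~ Q (u i)].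
Proof.
move=> oO O0; elim: n => [|n [Q [oQ Q0 QO Qu]]].
  have [oQ Q0] := open_setD1 (u 0%N) oO O0.
  exists (O `&` [set z | z <> u 0%N]); split=> // i.
  by rewrite leqn0 => /eqP -> [].
have [oQ' Q'0] := open_setD1 (u n.+1) oQ Q0.
exists (Q `&` [set z | z <> u n.+1]); split=> [//|//|z [/QO]//|i].
rewrite leq_eqVlt => /orP[/eqP -> []//|].
by rewrite ltnS => /Qu nQ [].
Qed.

(** The dense orbit visits [U x O] at a time [n] and [U' x O'] at a time [m], and [m - n] is a
    common hitting time once [n <= m]. To force this, the points of the second orbit up to time [n]
    are first removed from [O']. *)
Lemma hypercyclic_hitting (X : topologicalType) (T : X -> X) (S : V -> V)
    (U U' : set X) (O O' : set V) :
  weakly_disjoint T S -> open U -> open U' -> open O -> open O' ->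
  U !=set0 -> U' !=set0 -> O !=set0 -> O' !=set0 ->
  hitting_times T U U' `&` hitting_times S O O' !=set0.
Proof.
move=> [z zd] oU oU' oO oO' [x Ux] [x' U'x'] [y Oy] O'0.
have [p [[Un On] [n _ nE]]] :
    (U `*` O) `&` range (fun i => iter i (direct_sum T S) z) !=set0.
  by apply: zd; [exists (x, y)|exact: open_rect].
have [Q [oQ [y' Qy'] QO' Qz]] := open_avoid (fun i => iter i S z.2) n oO' O'0.
have [q [[Um Qm] [m _ mE]]] :
    (U' `*` Q) `&` range (fun i => iter i (direct_sum T S) z) !=set0.
  by apply: zd; [exists (x', y')|exact: open_rect].
move: Um Qm Un On; rewrite -mE -nE !iter_direct_sum /= => Um Qm Un On.
have nm : (n <= m)%N by rewrite leqNgt; apply/negP => /ltnW/Qz.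
exists (m - n)%N; split; apply/hitting_timesP.
  by exists (iter n T z.1) => //; rewrite -iterD subnK.
by exists (iter n S z.2) => //; rewrite -iterD subnK//; exact: QO'.
Qed.

End isolated_points.

(** * The weighted shift attached to a member of [tilde_family F] *)

Lemma distance_function (C : set int) : C 0 ->
  exists g : int -> nat, forall m,
    (exists2 z, C z & g m = `|m - z|%N) /\ forall z, C z -> (g m <= `|m - z|)%N.
Proof.
move=> C0.
suff /choice[g gP] : forall m, exists i, (exists2 z, C z & i = `|m - z|%N) /\
    forall z, C z -> (i <= `|m - z|)%N by exists g.
move=> m.
have ex : exists i, `[< exists2 z, C z & i = `|m - z|%N >].
  by exists `|m - 0|%N; apply/asboolP; exists 0.
case: (ex_minnP ex) => i /asboolP iC imin; exists i; split => // z Cz.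
by apply: imin; apply/asboolP; exists z.
Qed.

Lemma tilde_family_shift (R : realType) (k : scalar_kind) (s : seq_kind R)
    (F : set (set nat)) (A : set nat) :
  furstenberg_family F -> full_family F -> tilde_family F A ->
  exists S : {linear seq_space k s -> seq_space k s},
    [/\ continuous S, bilateral_weighted_backward_shift S, invertible S,
        family_mixing F S &
        exists U V, [/\ open U, open V, U !=set0, V !=set0 &
          hitting_times S U V `<=` A]].
Proof.
move=> F_family F_full [_ FA].
(* Including 0 gives [g 0 = 0]; using [|z|] makes the set symmetric, so that [A] controls [g] at
   both [n] and [- n]. *)
have [g gP] := @distance_function [set z | z = 0 \/ ~ A `|z|%N] (or_introl erefl).
have g0 : g 0 = 0%N.
  by apply/eqP; have [_ /(_ 0 (or_introl erefl))] := gP 0; rewrite subrr leqn0.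
have g_lip (m n : int) : (g (m + n)%R <= g m + `|n|)%N.
  have [[z Cz ->] _] := gP m; have [_ /(_ z Cz)/leq_trans] := gP (m + n).
  by apply; lia.
have gA (n : nat) : (0 < g n%:Z)%N -> A n.
  move=> gn; apply: contrapT => nA; have [_ /(_ n%:Z)] := gP n%:Z.
  by rewrite subrr leqNgt gn /=; apply/not_implyP; split => //; right.
(* A point [z] of the set at distance less than [l] from [n] or [- n] would have [|z|] in [A], by
   the translate by [n - z] or [n + z]; and [l < n] excludes [z = 0]. *)
have gtilde l (n : nat) : (l < n)%N ->
    (\bigcap_(i in [set i : int | - l%:Z <= i <= l%:Z]) translate A i) n%:Z ->
    (l <= g n%:Z)%N /\ (l <= g (- n%:Z))%N.
  move=> ln An; split; rewrite leqNgt; apply/negP => gl.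
    have [[z Cz zE] _] := gP n%:Z.
    have [|m Am mz] := An (n%:Z - z); first by rewrite /mkset; lia.
    have ez : z = m%:Z by lia.
    by case: Cz => [z0|]; [lia|rewrite ez absz_nat].
  have [[z Cz zE] _] := gP (- n%:Z).
  have [|m Am mz] := An (n%:Z + z); first by rewrite /mkset; lia.
  have ez : z = - m%:Z by lia.
  by case: Cz => [z0|]; [lia|rewrite ez abszN absz_nat].
exists (diag_shift g_lip 1); split.
- exact: diag_shift_continuous.
- exact: diag_shift_weighted.
- exact: diag_shift_invertible.
- move=> U V oU oV [u Uu] [v Vv].
  have [U1 [U2 [oU1 oU2 U1u U2u U12]]] := open_rect_sub oU Uu.
  have [V1 [V2 [oV1 oV2 V1v V2v V12]]] := open_rect_sub oV Vv.
  have [l1 hit1] := diag_shift_hits g_lip g0 oU1 oV1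
    (ex_intro _ _ U1u) (ex_intro _ _ V1v).
  have [l2 hit2] := diag_shift_hits g_lip g0 oU2 oV2
    (ex_intro _ _ U2u) (ex_intro _ _ V2v).
  (* The successor supplies the strict inequality [l < n] required by [gtilde]. *)
  apply: (family_sub F_family _
    (full_family_tail F_family (maxn l1 l2).+1 F_full (FA (maxn l1 l2)))).
  move=> n [An ln]; have [gn gn'] := gtilde _ _ ln An.
  rewrite !geq_max in gn gn'; move: gn gn' => /andP[? ?] /andP[? ?].
  have /hitting_timesP[x Ux Vx] : hitting_times (diag_shift g_lip 1) U1 V1 n.
    exact: hit1.
  have /hitting_timesP[y Uy Vy] : hitting_times (diag_shift g_lip 1) U2 V2 n.
    exact: hit2.
  apply/hitting_timesP; exists (x, y); first exact: U12.
  by rewrite iter_direct_sum; exact: V12.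
- have [U [V [? ? ? ? UV]]] := diag_shift_hitting_support (k := k) (s := s) g_lip g0.
  by exists U, V; split => // n /UV; exact: gA.
Qed.

Theorem theorem4p3 (R : realType) (k : scalar_kind) (Y : seq_kind R)
    (X : tvsType (scalar_field R k)) (T : {linear X -> X}) (F : set (set nat))
    (X_frechet : frechet_space X) (X_separable : separable_space X)
    (X_infdim : infinite_dimensional X) (T_continuous : continuous T)
    (F_family : furstenberg_family F) (F_full : full_family F) :
  [<-> family_transitive (dual_family (tilde_family F)) T;

       forall (Z : tvsType (scalar_field R k)) (S : {linear Z -> Z}),
         frechet_space Z -> separable_space Z -> infinite_dimensional Z ->
         continuous S -> family_mixing F S -> weakly_disjoint T S;

       forall S : {linear seq_space k Y -> seq_space k Y},
         continuous S -> bilateral_weighted_backward_shift S ->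
         invertible S -> family_mixing F S -> weakly_disjoint T S].

Proof.
split; last split.
- move=> T_trans Z S Z_frechet Z_separable _ cS.
  exact: dual_tilde_transitive_weakly_disjoint.
- move=> disj S cS _ _.
  apply: disj => //.
  + exact: seq_space_frechet.
  + exact: seq_space_separable.
  + exact: seq_space_infinite_dimensional.
(* Membership in the dual is tested on an arbitrary [A] in [tilde_family F]; the shift built from
   [A] has a hitting set inside [A], which the hitting times of [T] must meet. *)
- move=> disj U V oU oV U0 V0 A FA.
  have [S [cS wS iS mS [W [W' [oW oW' W0 W'0 WA]]]]] :=
    tilde_family_shift k Y F_family F_full FA.
  have [n [Tn Sn]] := hypercyclic_hitting (disj S cS wS iS mS) oU oV oW oW' U0 V0 W0 W'0.
  by exists n; split=> //; exact: WA.
Qed.
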